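(* Let $\pi_{can}:(\widetilde W,\omega_{can},S)\to B$ be the local model of a focus-focus fibration with semi-global invariant $S$, and let $\widetilde W_0=\pi_{can}^{-1}(B_0)$ be its regular part. Take the Lagrangian section $\Gamma(c)=(c,1)$ as the initial level set and the induced parametrization $T(c;t_1,t_2)=(c\,e^{-t_1+it_2},\,e^{t_1-it_2})$ of $\widetilde W_0$. Then action-angle coordinates on $\widetilde W_0$ are given by $$z_{\gamma_m}=\frac1{2\pi}\bigl[-\ln|c|\cdot c_1+\arg c\cdot c_2+c_1+S\bigr],\qquad z_{\gamma_e}=c_2,$$ $$\theta_{\gamma_e}=\frac{2\pi\, t_1}{S_1-\ln|c|},\qquad \theta_{\gamma_m}=t_2-\frac{S_2+\arg c}{S_1-\ln|c|}\,t_1,$$ that is, $$T^*(\omega_{can})=dz_{\gamma_m}\wedge d\theta_{\gamma_e}+dz_{\gamma_e}\wedge d\theta_{\gamma_m}.$$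
   Context: Local model. Let $0<\epsilon<1$, $B=\{c=c_1+ic_2\in\mathbb C:|c|<\epsilon\}$, $B_0=B\setminus\{0\}$. Let $S:\mathbb R^2\to\mathbb R$ be smooth with $S(0)=0$, regarded as a function of $c=(c_1,c_2)$, and $S_i=\partial S/\partial c_i$. Let $W=\mathbb C^2$ with coordinates $(z_1,z_2)$, $\omega_{can}=\mathrm{Re}(dz_1\wedge dz_2)$, and $\pi_{can}(z_1,z_2)=z_1z_2=c$. The Hamiltonian flows of $c_1=\mathrm{Re}(z_1z_2)$ and $c_2=\mathrm{Im}(z_1z_2)$ are $\phi_1^t(z_1,z_2)=(e^tz_1,e^{-t}z_2)$ and $\phi_2^t(z_1,z_2)=(e^{-it}z_1,e^{it}z_2)$. Let $\Pi_1=\{(c,1):|c|<\epsilon\}$ and $\Pi_2=\{(e^{S_1(c)-iS_2(c)},\,c\,e^{-S_1(c)+iS_2(c)}):|c|<\epsilon\}$, and let $\phi_2(\Pi_i)$ be the orbit of $\Pi_i$ under the circle action $\phi_2$. The space $\widetilde W$ is obtained from the part of $W$ over $B$ lying between $\phi_2(\Pi_1)$ and $\phi_2(\Pi_2)$ by gluing collar neighbourhoods of $\phi_2(\Pi_1)$ and $\phi_2(\Pi_2)$, fibre by fibre over $c=z_1z_2$, via $\psi(z_1,z_2)=(e^{S_1(c)-iS_2(c)}z_2^{-1},\,e^{-S_1(c)+iS_2(c)}z_1z_2^2)$; for $c\neq 0$, $\psi$ is the joint flow of $(c_1,c_2)$ at time $(S_1-\ln|c|,\,S_2+\arg c)$.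 Fibres over $B_0$ are 2-tori and the central fibre is a pinched torus; $\omega_{can}$ descends to $\widetilde W$. Parametrization. $T(c;t_1,t_2)=\phi_1^{-t_1}\circ\phi_2^{-t_2}(c,1)$ identifies $\{(c;t)\in B_0\times\mathbb R^2\}$ modulo, over each $c$, the period lattice $L=\langle (S_1-\ln|c|,\,S_2+\arg c),\,(0,2\pi)\rangle$, with $\widetilde W_0$. It is assumed that $L$ is a lattice, i.e. $S_1-\ln|c|\neq0$ on $B_0$. A local branch of $\arg c$ (equivalently of $\ln c=\ln|c|+i\arg c$) is fixed in all formulas. Action coordinates are the action integrals $z_\gamma=\frac1{2\pi}\int_\gamma\alpha$, with $d\alpha=\omega_{can}$ near a fibre and $\gamma_m,\gamma_e$ generators of the first homology of the fibre (up to additive constants); in the angle coordinates $(\theta_{\gamma_m},\theta_{\gamma_e})$ the period lattice is the standard one $\langle(2\pi,0),(0,2\pi)\rangle$. *)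

(* Defs.v *)
From Stdlib Require Import Reals ZArith Relations Lra Lia.
From Coquelicot Require Import Coquelicot.
Open Scope R_scope.

(* Tangent vectors, 1-forms and Frechet derivatives are real: C and C * C are
   used as normed modules over R (Coquelicot's canonical structure on C is the
   one over the field C). *)
Definition R2 : NormedModule R_AbsRing := C_R_NormedModule.
Definition R4 : NormedModule R_AbsRing := prod_NormedModule R_AbsRing R2 R2.

Section Smooth.

Context {V : NormedModule R_AbsRing}.

Fixpoint Ck_on (n : nat) (D : V -> Prop) (f : V -> R) : Prop :=
  match n with
  | O => forall p, D p -> continuous f p
  | S m => exists df : V -> V -> R,
      (forall p, D p -> filterdiff f (locally p) (df p)) /\
      (forall v, Ck_on m D (fun p => df p v))
  end.

Definition smooth_on (D : V -> Prop) (f : V -> R) : Prop :=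
  forall n, Ck_on n D f.

Definition wedge (a b : V -> R) (v w : V) : R := a v * b w - a w * b v.

(* d(alpha)(v, w) = D_v (alpha w) - D_w (alpha v), for constant fields v, w. *)
Definition ext_d (alpha : V -> V -> R) (z v w : V) : R :=
  Derive (fun s : R => alpha (plus z (scal s v)) w) 0 -
  Derive (fun s : R => alpha (plus z (scal s w)) v) 0.

End Smooth.

Definition cexp (u : C) : C :=
  (exp (fst u) * cos (snd u), exp (fst u) * sin (snd u)).

(* The base *)

Definition B (eps : R) (c : C) : Prop := Cmod c < eps.
Definition B0 (eps : R) (c : C) : Prop := B eps c /\ c <> RtoC 0.

Section Local_model.

Variables (eps : R) (S : R2 -> R).

Definition S1 (c : C) : R := Derive (fun x : R => S (x, snd c)) (fst c).
Definition S2 (c : C) : R := Derive (fun y : R => S (fst c, y)) (snd c).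

Definition pi_can (z : C * C) : C := Cmult (fst z) (snd z).

(* Re (dz_1 /\ dz_2), which has constant coefficients. *)
Definition omega_can (v w : C * C) : R :=
  fst (Cminus (Cmult (fst v) (snd w)) (Cmult (fst w) (snd v))).

Definition phi1 (t : R) (z : C * C) : C * C :=
  (Cmult (cexp (t, 0)) (fst z), Cmult (cexp (- t, 0)) (snd z)).
Definition phi2 (t : R) (z : C * C) : C * C :=
  (Cmult (cexp (0, - t)) (fst z), Cmult (cexp (0, t)) (snd z)).

Definition Pi1 (z : C * C) : Prop :=
  exists c, B eps c /\ z = (c, RtoC 1).
Definition Pi2 (z : C * C) : Prop :=
  exists c, B eps c /\
    z = (cexp (S1 c, - S2 c), Cmult c (cexp (- S1 c, S2 c))).
Definition phi2_orbit (P : C * C -> Prop) (z : C * C) : Prop :=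
  exists t p, P p /\ z = phi2 t p.

Definition psi (z : C * C) : C * C :=
  let c := pi_can z in
  (Cmult (cexp (S1 c, - S2 c)) (Cinv (snd z)),
   Cmult (cexp (- S1 c, S2 c)) (Cmult (fst z) (Cmult (snd z) (snd z)))).

(* The points of the glued space are the points of W over B up to [glued], the
   equivalence relation generated by z ~ psi z.  Two points of W over B are
   glued exactly when they continue each other through the collars, so this is
   the space glued from the region [between] (see [between_meets_orbit] and
   [between_glued]; S1 - ln|c| is positive on B0 as soon as it vanishes nowhere
   there, since it tends to +oo at 0).  Over c = 0 the punctured z_2-axis is
   glued to the punctured z_1-axis, which gives the pinched torus. *)
Definition glue_step (z w : C * C) : Prop :=
  B eps (pi_can z) /\ snd z <> RtoC 0 /\ w = psi z.
Definition glued : C * C -> C * C -> Prop := clos_refl_sym_trans _ glue_step.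

(* |z_2| = 1 on phi2(Pi1), and |z_1| = exp (S1 c) on phi2(Pi2).  For c <> 0 the
   second bound reads |z_2| >= |c| exp (- S1 c); for c = 0 the two bounds cut
   the two axes. *)
Definition between (z : C * C) : Prop :=
  B eps (pi_can z) /\ Cmod (snd z) <= 1 /\ Cmod (fst z) <= exp (S1 (pi_can z)).

Definition Gamma (c : C) : C * C := (c, RtoC 1).

(* The argument is (c, (t_1, t_2)). *)
Definition Tpar (p : C * C) : C * C :=
  phi1 (- fst (snd p)) (phi2 (- snd (snd p)) (Gamma (fst p))).

(* A branch of arg on the open set U. *)
Definition arg_branch (U : C -> Prop) (arg : C -> R) : Prop :=
  forall c, U c ->
    @continuous C_UniformSpace R_UniformSpace arg c /\
    c = Cmult (RtoC (Cmod c)) (cexp (0, arg c)).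

Section Branch.

Variable arg : C -> R.

Definition period_m (c : C) : R * R := (S1 c - ln (Cmod c), S2 c + arg c).
Definition period_e (c : C) : R * R := (0, 2 * PI).

Definition period_lattice (c : C) (t : R * R) : Prop :=
  exists m n : Z,
    fst t = IZR m * fst (period_m c) + IZR n * fst (period_e c) /\
    snd t = IZR m * snd (period_m c) + IZR n * snd (period_e c).

Definition z_m (c : C) : R :=
  / (2 * PI) *
  (- ln (Cmod c) * fst c + arg c * snd c + fst c + S c).
Definition z_e (c : C) : R := snd c.

Definition theta_e (p : C * C) : R :=
  let (c, t) := p in 2 * PI * fst t / (S1 c - ln (Cmod c)).
Definition theta_m (p : C * C) : R :=
  let (c, t) := p in
  snd t - (S2 c + arg c) / (S1 c - ln (Cmod c)) * fst t.

End Branch.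

(* A smooth 1-form on the part of the glued space over V is a psi-invariant
   one on the part of W over V. *)
Definition primitive_over (V : C -> Prop) (alpha : R4 -> R4 -> R) : Prop :=
  (forall z : R4, V (pi_can z) -> is_linear (alpha z)) /\
  (forall v : R4,
     smooth_on (fun z : R4 => V (pi_can z)) (fun z : R4 => alpha z v)) /\
  (forall (z : R4) (dpsi : R4 -> R4), V (pi_can z) ->
     filterdiff (psi : R4 -> R4) (locally z) dpsi ->
     forall v, alpha (psi z) (dpsi v) = alpha z v) /\
  (forall z v w : R4, V (pi_can z) -> ext_d alpha z v w = omega_can v w).

(* For c in B0, t |-> T(c; t) is the universal covering of the fibre over c,
   with deck group the period lattice; so a loop of the fibre is given by a
   lift g to the t-plane, and its homology class is the displacement
   lambda = g(1) - g(0). *)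
Definition fibre_loop (lambda : R * R) (g : R -> R * R) : Prop :=
  (forall s, ex_derive (fun x => fst (g x)) s /\
             ex_derive (fun x => snd (g x)) s /\
             continuous (Derive (fun x => fst (g x))) s /\
             continuous (Derive (fun x => snd (g x))) s) /\
  fst (g 1) = fst (g 0) + fst lambda /\ snd (g 1) = snd (g 0) + snd lambda.

Definition velocity (gam : R -> C * C) (s : R) : C * C :=
  ((Derive (fun x => fst (fst (gam x))) s,
    Derive (fun x => snd (fst (gam x))) s),
   (Derive (fun x => fst (snd (gam x))) s,
    Derive (fun x => snd (snd (gam x))) s)).

Definition path_integral (alpha : R4 -> R4 -> R) (gam : R -> C * C) : R :=
  RInt (fun s => alpha (gam s) (velocity gam s)) 0 1.

(* Near c0, zg is the action (1 / 2 pi) \int_{gamma(c)} alpha, up to an additive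
   constant, where gamma(c) is the loop of class lambda c in the fibre over c.
   Any two primitives near the fibre give the same action up to a constant. *)
Definition is_action_integral
    (c0 : C) (lambda : C -> R * R) (zg : C -> R) : Prop :=
  let near_fibre V alpha :=
    open (T := C_UniformSpace) V /\ V c0 /\ (forall c, V c -> B0 eps c) /\
    primitive_over V alpha in
  (exists V alpha, near_fibre V alpha) /\
  (forall V alpha, near_fibre V alpha ->
     exists K : R, locally (T := C_UniformSpace) c0 (fun c =>
       forall g, fibre_loop (lambda c) g ->
         zg c = / (2 * PI) * path_integral alpha (fun s => Tpar (c, g s)) + K)).

End Local_model.

Definition eq_mod_2pi (x y : R) : Prop := exists k : Z, x - y = 2 * PI * IZR k.

Lemma cexp_plus (a b : C) : cexp (Cplus a b) = Cmult (cexp a) (cexp b).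
Proof.
destruct a as [a1 a2], b as [b1 b2]; unfold cexp, Cmult, Cplus; simpl.
rewrite exp_plus, cos_plus, sin_plus; f_equal; ring.
Qed.

Lemma cexp_cancel (x y : R) : Cmult (cexp (x, - y)) (cexp (- x, y)) = RtoC 1.
Proof.
rewrite <- cexp_plus; unfold Cplus; simpl.
rewrite !Rplus_opp_r, Rplus_opp_l; unfold cexp; simpl.
rewrite exp_0, cos_0, sin_0; unfold RtoC; f_equal; ring.
Qed.

Lemma exp_mono (x y : R) : x <= y -> exp x <= exp y.
Proof.
intros [L | ->]; [left; apply exp_increasing; exact L | right; reflexivity].
Qed.

Lemma Cmod_cexp (u : C) : Cmod (cexp u) = exp (fst u).
Proof.
destruct u as [x y]; unfold Cmod, cexp; simpl.
replace (_ + _) with (exp x * exp x).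
  apply sqrt_square; left; apply exp_pos.
generalize (sin2_cos2 y); unfold Rsqr; intros E.
transitivity (exp x * exp x * (sin y * sin y + cos y * cos y)); [rewrite E|]; ring.
Qed.

Lemma cexp_neq0 (u : C) : cexp u <> RtoC 0.
Proof.
intros E; generalize (exp_pos (fst u)); rewrite <- Cmod_cexp, E, Cmod_0; lra.
Qed.

Lemma polar_unit (z : C) : Cmod z = 1 -> exists t, z = cexp (0, t).
Proof.
destruct z as [x y]; unfold Cmod, cexp; simpl; intros E.
assert (E2 : x * x + y * y = 1).
  rewrite <- (sqrt_sqrt (x * x + y * y)) by nra.
  replace (x * x + y * y) with (x * (x * 1) + y * (y * 1)) by ring.
  rewrite E; ring.
assert (Hx : -1 <= x <= 1) by nra.
rewrite exp_0.
assert (Hs : sin (acos x) = Rabs y).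
  rewrite sin_acos by exact Hx; unfold Rsqr.
  replace (1 - x * x) with (Rsqr y) by (unfold Rsqr; lra).
  apply sqrt_Rsqr_abs.
destruct (Rle_or_lt 0 y) as [Hy | Hy].
- exists (acos x); rewrite cos_acos, Hs, Rabs_pos_eq by assumption; f_equal; ring.
- exists (- acos x).
  rewrite cos_neg, sin_neg, cos_acos, Hs, Rabs_left by assumption; f_equal; ring.
Qed.

Section Fundamental_domain.

Variables (eps : R) (S : R2 -> R).

Notation gap c := (S1 S c - ln (Cmod c)).

Lemma pi_can_psi (z : C * C) :
  snd z <> RtoC 0 -> pi_can (psi S z) = pi_can z.
Proof.
intros Hz; unfold psi; cbv zeta.
set (c := pi_can z); unfold pi_can; simpl.
transitivity (Cmult (Cmult (cexp (S1 S c, - S2 S c)) (cexp (- S1 S c, S2 S c)))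
  (Cmult (fst z) (snd z))).
  field; exact Hz.
rewrite cexp_cancel; unfold c, pi_can; ring.
Qed.

Lemma snd_neq0 (z : C * C) : pi_can z <> RtoC 0 -> snd z <> RtoC 0.
Proof. intros H E; apply H; unfold pi_can; rewrite E; ring. Qed.

Lemma fst_snd (z : C * C) :
  pi_can z <> RtoC 0 -> fst z = Cmult (pi_can z) (Cinv (snd z)).
Proof. intros H; unfold pi_can; field; exact (snd_neq0 z H). Qed.

Lemma eq_of_snd (z w : C * C) : pi_can z <> RtoC 0 ->
  pi_can z = pi_can w -> snd z = snd w -> z = w.
Proof.
intros H E1 E2; rewrite (surjective_pairing z), (surjective_pairing w).
rewrite (fst_snd z H), (fst_snd w) by (rewrite <- E1; exact H).
rewrite E1, E2; reflexivity.
Qed.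

Lemma snd_psi (z : C * C) : snd (psi S z) =
  Cmult (cexp (- S1 S (pi_can z), S2 S (pi_can z))) (Cmult (pi_can z) (snd z)).
Proof. unfold psi; simpl; unfold pi_can; ring. Qed.

Lemma ln_snd_psi (z : C * C) : pi_can z <> RtoC 0 ->
  ln (Cmod (snd (psi S z))) = ln (Cmod (snd z)) - gap (pi_can z).
Proof.
intros H; rewrite snd_psi, !Cmod_mult, Cmod_cexp; simpl.
assert (0 < Cmod (pi_can z)) by (apply Cmod_gt_0; exact H).
assert (0 < Cmod (snd z)) by (apply Cmod_gt_0; apply snd_neq0; exact H).
rewrite ln_mult, ln_mult, ln_exp; try assumption; try lra.
- apply exp_pos.
- apply Rmult_lt_0_compat; assumption.
Qed.

Lemma psi_inj (z w : C * C) : pi_can z <> RtoC 0 -> pi_can z = pi_can w ->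
  psi S z = psi S w -> z = w.
Proof.
intros H E1 E; apply eq_of_snd; [exact H | exact E1 |].
assert (E2 : snd (psi S z) = snd (psi S w)) by (rewrite E; reflexivity).
rewrite !snd_psi, <- E1 in E2.
set (k := cexp _) in E2.
assert (Hk : k <> RtoC 0) by apply cexp_neq0.
replace (snd z) with (Cmult (Cinv (Cmult k (pi_can z)))
  (Cmult k (Cmult (pi_can z) (snd z)))) by (field; split; assumption).
rewrite E2; field; split; assumption.
Qed.

Lemma iter_psi (n : nat) (z : C * C) : pi_can z <> RtoC 0 ->
  pi_can (Nat.iter n (psi S) z) = pi_can z /\
  ln (Cmod (snd (Nat.iter n (psi S) z))) =
    ln (Cmod (snd z)) - INR n * gap (pi_can z).
Proof.
intros H; induction n as [|n [IH1 IH2]]; [simpl; split; [reflexivity | ring]|].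
change (Nat.iter (Datatypes.S n) (psi S) z) with (psi S (Nat.iter n (psi S) z)).
assert (H' : pi_can (Nat.iter n (psi S) z) <> RtoC 0) by (rewrite IH1; exact H).
rewrite pi_can_psi by (apply snd_neq0; exact H').
rewrite ln_snd_psi by exact H'.
rewrite IH2, IH1, S_INR; split; [reflexivity | ring].
Qed.

Lemma iter_psi_inj (n : nat) (z w : C * C) :
  pi_can z <> RtoC 0 -> pi_can z = pi_can w ->
  Nat.iter n (psi S) z = Nat.iter n (psi S) w -> z = w.
Proof.
intros H E; induction n as [|n IH]; [trivial|].
intros E2; apply IH; apply (psi_inj (Nat.iter n (psi S) z)).
- rewrite (proj1 (iter_psi n z H)); exact H.
- assert (Hw : pi_can w <> RtoC 0) by (rewrite <- E; exact H).
  rewrite (proj1 (iter_psi n z H)), (proj1 (iter_psi n w Hw)); exact E.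
- exact E2.
Qed.

Lemma glued_pi_can (z w : C * C) : glued eps S z w -> pi_can z = pi_can w.
Proof.
induction 1 as [z w (_ & H & ->) | | | ]; try congruence.
symmetry; apply pi_can_psi; exact H.
Qed.

Lemma glued_iter (z w : C * C) : glued eps S z w -> pi_can z <> RtoC 0 ->
  exists n, w = Nat.iter n (psi S) z \/ z = Nat.iter n (psi S) w.
Proof.
induction 1 as [z w (_ & H & ->) | z | z w Hzw IH | z y w Hzy IH1 Hyw IH2];
  intros Hz.
- exists 1%nat; left; reflexivity.
- exists 0%nat; left; reflexivity.
- destruct IH as [n [E | E]].
  + rewrite (glued_pi_can _ _ Hzw); exact Hz.
  + exists n; right; exact E.
  + exists n; left; exact E.
- assert (E1 := glued_pi_can _ _ Hzy); assert (E2 := glued_pi_can _ _ Hyw).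
  destruct IH1 as [n En]; [exact Hz|].
  destruct IH2 as [m Em]; [rewrite <- E1; exact Hz|].
  destruct En as [-> | ->], Em as [-> | Em].
  + exists (m + n)%nat; left; symmetry; apply Nat.iter_add.
  + destruct (Nat.le_ge_cases n m) as [L | L].
    * exists (m - n)%nat; right.
      apply (iter_psi_inj n); [exact Hz | |].
      { rewrite (proj1 (iter_psi _ w ltac:(congruence))); congruence. }
      rewrite Em, <- Nat.iter_add; f_equal; lia.
    * exists (n - m)%nat; left; symmetry.
      apply (iter_psi_inj m).
      { rewrite (proj1 (iter_psi _ z Hz)); exact Hz. }
      { rewrite (proj1 (iter_psi _ z Hz)); congruence. }
      rewrite <- Em, <- Nat.iter_add; f_equal; lia.
  + destruct (Nat.le_ge_cases n m) as [L | L].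
    * exists (m - n)%nat; left; rewrite <- Nat.iter_add; f_equal; lia.
    * exists (n - m)%nat; right; rewrite <- Nat.iter_add; f_equal; lia.
  + subst y; exists (n + m)%nat; right; symmetry; apply Nat.iter_add.
Qed.

Lemma glued_iter_psi (n : nat) (z : C * C) :
  B0 eps (pi_can z) -> glued eps S z (Nat.iter n (psi S) z).
Proof.
intros [Hb H]; induction n as [|n IH]; [apply rst_refl|].
eapply rst_trans; [exact IH | apply rst_step].
destruct (iter_psi n z H) as [E _]; rewrite <- E in Hb, H.
split; [exact Hb | split; [exact (snd_neq0 _ H) | reflexivity]].
Qed.

Lemma iter_psi_surj (n : nat) (z : C * C) : pi_can z <> RtoC 0 ->
  exists w, pi_can w = pi_can z /\ Nat.iter n (psi S) w = z.
Proof.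
intros H; induction n as [|n [w [E1 E2]]]; [exists z; split; reflexivity|].
assert (Hw : pi_can w <> RtoC 0) by (rewrite E1; exact H).
assert (Hw2 := snd_neq0 w Hw).
set (c := pi_can w) in *; set (k := cexp (- S1 S c, S2 S c)).
assert (Hk : k <> RtoC 0) by apply cexp_neq0.
set (y := Cmult (snd w) (Cinv (Cmult k c))).
assert (Hy : y <> RtoC 0).
  unfold y; apply Cmult_neq_0; [exact Hw2|].
  intros E0; apply (C1_nz); rewrite <- (Cinv_r (Cmult k c)).
    rewrite E0; ring.
  apply Cmult_neq_0; assumption.
pose (v := (Cmult c (Cinv y), y)).
assert (Ev : pi_can v = c) by (unfold v, pi_can; simpl; field; exact Hy).
exists v; split; [congruence|].
rewrite Nat.iter_succ_r, <- E2; f_equal.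
apply eq_of_snd.
- rewrite pi_can_psi by exact Hy; rewrite Ev; exact Hw.
- rewrite pi_can_psi by exact Hy; exact Ev.
- rewrite snd_psi, Ev; fold k; unfold v, y; simpl; field; split; assumption.
Qed.

Lemma betweenP (z : C * C) : B0 eps (pi_can z) ->
  between eps S z <-> - gap (pi_can z) <= ln (Cmod (snd z)) <= 0.
Proof.
intros [Hb H]; assert (H2 := snd_neq0 z H).
assert (P2 : 0 < Cmod (snd z)) by (apply Cmod_gt_0; exact H2).
assert (H1 : fst z <> RtoC 0).
  intros E; apply H; unfold pi_can; rewrite E; ring.
assert (P1 : 0 < Cmod (fst z)) by (apply Cmod_gt_0; exact H1).
assert (E : ln (Cmod (pi_can z)) = ln (Cmod (fst z)) + ln (Cmod (snd z))).
  unfold pi_can; rewrite Cmod_mult, ln_mult; trivial.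
unfold between; split.
- intros (_ & L1 & L2); split.
  + assert (ln (Cmod (fst z)) <= S1 S (pi_can z)); [|lra].
    rewrite <- (ln_exp (S1 S (pi_can z))); apply ln_le; assumption.
  + rewrite <- ln_1; apply ln_le; assumption.
- intros [L1 L2]; split; [exact Hb | split].
  + rewrite <- (exp_ln (Cmod (snd z))), <- exp_0 by exact P2.
    apply exp_mono; exact L2.
  + rewrite <- (exp_ln (Cmod (fst z))) by exact P1.
    apply exp_mono; lra.
Qed.

Lemma between_meets_orbit (z : C * C) :
  B0 eps (pi_can z) -> 0 < gap (pi_can z) ->
  exists w, between eps S w /\ glued eps S z w.
Proof.
intros HB HA; assert (H := proj2 HB).
set (A := gap (pi_can z)) in *; set (x := ln (Cmod (snd z))).
assert (Hk : exists k : Z, - A <= x - IZR k * A <= 0).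
  exists (up (x / A)); destruct (archimed (x / A)) as [U1 U2].
  assert (Ex : x = x / A * A) by (field; lra).
  split; rewrite Ex at 1; nra.
destruct Hk as [k Hk]; destruct (Z_le_gt_dec 0 k) as [Lk | Lk].
- destruct (iter_psi (Z.to_nat k) z H) as [E1 E2].
  exists (Nat.iter (Z.to_nat k) (psi S) z); split.
  + apply betweenP; rewrite E1; [exact HB|]; fold A.
    rewrite E2, INR_IZR_INZ, Z2Nat.id by exact Lk; exact Hk.
  + apply glued_iter_psi; exact HB.
- destruct (iter_psi_surj (Z.to_nat (- k)) z H) as [w [Ew E]].
  assert (Hw : pi_can w <> RtoC 0) by (rewrite Ew; exact H).
  exists w; split.
  + apply betweenP; rewrite Ew; [exact HB|]; fold A.
    destruct (iter_psi (Z.to_nat (- k)) w Hw) as [_ E2].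
    rewrite E, Ew, INR_IZR_INZ, Z2Nat.id, opp_IZR in E2 by lia.
    fold A x in E2; lra.
  + apply rst_sym; rewrite <- E; apply glued_iter_psi; rewrite Ew; exact HB.
Qed.

Lemma between_glued (z w : C * C) :
  B0 eps (pi_can z) -> 0 < gap (pi_can z) ->
  between eps S z -> between eps S w -> glued eps S z w ->
  let seam p q := phi2_orbit (Pi1 eps) p /\ phi2_orbit (Pi2 eps S) q /\
                  q = psi S p in
  z = w \/ seam z w \/ seam w z.
Proof.
intros HB HA Bz Bw G seam.
assert (H := proj2 HB); assert (Ep := glued_pi_can z w G).
apply betweenP in Bz; [|exact HB].
apply betweenP in Bw; [|rewrite <- Ep; exact HB]; rewrite <- Ep in Bw.
set (A := gap (pi_can z)) in *.
assert (K : forall p n, pi_can p = pi_can z -> - A <= ln (Cmod (snd p)) <= 0 ->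
  - A <= ln (Cmod (snd (Nat.iter n (psi S) p))) <= 0 ->
  p = Nat.iter n (psi S) p \/ seam p (Nat.iter n (psi S) p)).
{ intros p n E Lp Lq; assert (Hp : pi_can p <> RtoC 0) by (rewrite E; exact H).
  rewrite (proj2 (iter_psi n p Hp)), E in Lq; fold A in Lq.
  destruct n as [|[|n]]; [left; reflexivity | right | exfalso].
  - simpl in Lq |- *.
    assert (M : Cmod (snd p) = 1).
    { rewrite <- (exp_ln (Cmod (snd p))) by (apply Cmod_gt_0, snd_neq0, Hp).
      replace (ln (Cmod (snd p))) with 0 by lra; apply exp_0. }
    destruct (polar_unit _ M) as [t Et].
    assert (Hs := snd_neq0 p Hp).
    assert (Ei : Cmult (cexp (0, - t)) (cexp (0, t)) = RtoC 1).
    { rewrite <- (cexp_cancel 0 t), Ropp_0; reflexivity. }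
    assert (Einv : Cinv (snd p) = cexp (0, - t)).
    { replace (Cinv (snd p)) with (Cmult (Cmult (cexp (0, - t)) (snd p))
        (Cinv (snd p))) by (rewrite Et, Ei; ring).
      field; exact Hs. }
    assert (Hbp : B eps (pi_can p)) by (rewrite E; exact (proj1 HB)).
    split; [|split; [|reflexivity]].
    + exists t, (pi_can p, RtoC 1); split; [exists (pi_can p); auto|].
      unfold phi2; simpl.
      rewrite (surjective_pairing p) at 1; f_equal.
      * rewrite (fst_snd p Hp), Einv; ring.
      * rewrite Et; ring.
    + exists t, (cexp (S1 S (pi_can p), - S2 S (pi_can p)),
        Cmult (pi_can p) (cexp (- S1 S (pi_can p), S2 S (pi_can p)))).
      split; [exists (pi_can p); auto|].
      rewrite (surjective_pairing (psi S p)), snd_psi; unfold phi2, psi; simpl.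
      rewrite Einv; f_equal; [ring | rewrite Et; ring].
  - rewrite !S_INR in Lq; generalize (pos_INR n); nra. }
destruct (glued_iter z w G H) as [n [-> | ->]].
- destruct (K z n eq_refl Bz Bw); auto.
- destruct (K w n (eq_sym Ep) Bw Bz); auto.
Qed.

End Fundamental_domain.

(* Main.v *)
Require Import Defs.
From Stdlib Require Import Reals ZArith Relations List Lra Lia FunctionalExtensionality.
From Coquelicot Require Import Coquelicot.
Open Scope R_scope.

(* With tau = (tau1, tau2) the first period, 2 pi dz_m = tau1 dc1 + tau2 dc2: the
   derivatives of ln|c| and arg c cancel against dc1. In particular tau1 dc1 +
   tau2 dc2 is closed, which is what turns T^* omega = dc1 /\ dt1 + dc2 /\ dt2
   into dz_m /\ dtheta_e + dz_e /\ dtheta_m, and since tau1 does not vanish,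
   (z_m, z_e) is a local chart of the base. As psi (T (c; t)) = T (c; t - tau),
   two points T (c; t) are glued iff their times differ by a period.

   For any primitive alpha of omega, Stokes' theorem on a homotopy of loops whose
   base point moves from c0 to c gives d (int_gamma alpha) = tau1 dc1 + tau2 dc2;
   the ends of the loops contribute nothing because alpha is psi-invariant. A
   psi-invariant primitive is Re (z_1 dz_2) - d (h ln|z_2| / tau1) with
   h = c1 S_1 + c2 S_2 - c1 - S, because psi^* changes Re (z_1 dz_2) by - dh and
   ln|z_2| by - tau1. *)

(** * Calculus in normed modules *)

(** The action statement ranges over every invariant primitive and every loop of the given class, so
    nothing may be computed with one chosen form. The comparison is therefore made in (c; t) space:
    there a loop is a path in a plane and can be interpolated linearly, and T^* omega has constant
    coefficients, so the Stokes term has an explicit antiderivative along the loop. Both cycles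
    share one argument, with a map that carries the end of the loop back to its start: [psi] for
    gamma_m, the identity for gamma_e, whose period (0, 2 pi) [Tpar] already absorbs.

    The function h comes from z_1 dz_2 = c d(ln z_2). As [psi] multiplies z_2 by c exp (- S_1 + i
    S_2), it adds to Re (z_1 dz_2) the form Re (dc + c (- dS_1 + i dS_2)) = dc1 - c1 dS_1 - c2 dS_2.
    The Legendre transform c1 S_1 + c2 S_2 - S has differential c1 dS_1 + c2 dS_2, which makes this
    form exact.

    The technical obstacle is that [Ck_on] controls differentials only in fixed directions, whereas
    forms are evaluated on moving vectors; such expressions are expanded in coordinates first. *)

Lemma is_derive_along {V W : NormedModule R_AbsRing} (h : V -> W) (z : R -> V)
  (x : R) (z' : V) (dh : V -> W) :
  filterdiff h (locally (z x)) dh -> is_derive z x z' ->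
  is_derive (fun x => h (z x)) x (dh z').
Proof.
intros Hh Hz.
apply (filterdiff_ext_lin _ (fun y : R => dh (scal y z'))).
- exact (filterdiff_comp' z h x (fun y => scal y z') dh Hz Hh).
- intros y; exact (linear_scal _ (proj1 Hh) y z').
Qed.

Lemma is_derive_line {V : NormedModule R_AbsRing} (p u : V) (x : R) :
  is_derive (fun s => plus p (scal s u)) x u.
Proof.
apply (filterdiff_ext_lin _ (fun s : R => plus zero (scal s u))).
- apply (filterdiff_plus_fct (U := AbsRing_NormedModule R_AbsRing)
    (fun _ => p) (fun s => scal s u) (fun _ => zero) (fun s => scal s u)).
  + apply filterdiff_const.
  + apply filterdiff_scal_l.
- intros s; apply plus_zero_l.
Qed.

Section Calculus.

Context {V : NormedModule R_AbsRing}.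

(** The rules [diff_plus] to [diff_div] are the usual ones with real [+] and [*] in place of [plus]
    and [scal], so that they compose as terms and the resulting linear maps can be compared by
    [ring] or [field]. *)
Lemma diff_ext_lin (f : V -> R) (p : V) (l1 l2 : V -> R) :
  filterdiff f (locally p) l1 -> (forall v, l1 v = l2 v) ->
  filterdiff f (locally p) l2.
Proof. intros H E; exact (filterdiff_ext_lin _ _ _ H E). Qed.

Lemma diff_plus (f g : V -> R) (p : V) (df dg : V -> R) :
  filterdiff f (locally p) df -> filterdiff g (locally p) dg ->
  filterdiff (fun x => f x + g x) (locally p) (fun v => df v + dg v).
Proof. intros Hf Hg; exact (filterdiff_plus_fct _ _ _ _ Hf Hg). Qed.

Lemma diff_opp (f : V -> R) (p : V) (df : V -> R) :
  filterdiff f (locally p) df ->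
  filterdiff (fun x => - f x) (locally p) (fun v => - df v).
Proof. intros Hf; exact (filterdiff_opp_fct _ _ Hf). Qed.

Lemma diff_minus (f g : V -> R) (p : V) (df dg : V -> R) :
  filterdiff f (locally p) df -> filterdiff g (locally p) dg ->
  filterdiff (fun x => f x - g x) (locally p) (fun v => df v - dg v).
Proof. intros Hf Hg; exact (filterdiff_minus_fct _ _ _ _ Hf Hg). Qed.

Lemma diff_mult (f g : V -> R) (p : V) (df dg : V -> R) :
  filterdiff f (locally p) df -> filterdiff g (locally p) dg ->
  filterdiff (fun x => f x * g x) (locally p) (fun v => df v * g p + f p * dg v).
Proof.
intros Hf Hg; exact (filterdiff_mult_fct f g p df dg Rmult_comm Hf Hg).
Qed.

Lemma diff_const (a : R) (p : V) :
  filterdiff (fun _ : V => a) (locally p) (fun _ => 0).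
Proof. exact (filterdiff_const (K := R_AbsRing) (V := R_NormedModule) a). Qed.

Lemma diff_comp (F : R -> R) (l : R) (f : V -> R) (p : V) (df : V -> R) :
  is_derive F (f p) l -> filterdiff f (locally p) df ->
  filterdiff (fun x => F (f x)) (locally p) (fun v => l * df v).
Proof.
intros HF Hf.
apply (diff_ext_lin _ _ (fun v => scal (df v) l)).
  exact (filterdiff_comp' f F p df (fun y => scal y l) Hf HF).
intros v; apply Rmult_comm.
Qed.

Lemma diff_inv (f : V -> R) (p : V) (df : V -> R) :
  f p <> 0 -> filterdiff f (locally p) df ->
  filterdiff (fun x => / f x) (locally p) (fun v => - (df v / (f p * f p))).
Proof.
intros H Hf.
apply (diff_ext_lin _ _ (fun v => - / f p ^ 2 * df v)).
- apply (diff_comp Rinv); [|exact Hf].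
  auto_derive; [exact H | field; exact H].
- intros v; field; exact H.
Qed.

Lemma diff_div (f g : V -> R) (p : V) (df dg : V -> R) : g p <> 0 ->
  filterdiff f (locally p) df -> filterdiff g (locally p) dg ->
  filterdiff (fun x => f x / g x) (locally p)
    (fun v => (df v * g p - f p * dg v) / (g p * g p)).
Proof.
intros H Hf Hg.
apply (diff_ext_lin _ _
  (fun v => df v * / g p + f p * - (dg v / (g p * g p)))).
- exact (diff_mult _ _ _ _ _ Hf (diff_inv _ _ _ H Hg)).
- intros v; field; exact H.
Qed.

Lemma diff_line (f : V -> R) (z v : V) (x : R) (df : V -> R) :
  filterdiff f (locally (plus z (scal x v))) df ->
  is_derive (fun s => f (plus z (scal s v))) x (df v).
Proof.
intros Hf; exact (is_derive_along f _ x v df Hf (is_derive_line z v x)).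
Qed.

Lemma plus_scal_0 (z v : V) : plus z (scal 0 v) = z.
Proof.
transitivity (plus z zero); [|apply plus_zero_r].
f_equal; exact (scal_zero_l v).
Qed.

Lemma diff_line_0 (f : V -> R) (z v : V) (df : V -> R) :
  filterdiff f (locally z) df ->
  is_derive (fun s => f (plus z (scal s v))) 0 (df v).
Proof. intros Hf; apply diff_line; rewrite plus_scal_0; exact Hf. Qed.

(** A differential is recovered from derivatives along lines, which are unique. This allows two
    computations of the differential of one function to be equated, as in [primitive_invariant]. *)
Lemma diff_unique (f : V -> R) (z : V) (df dg : V -> R) :
  filterdiff f (locally z) df -> filterdiff f (locally z) dg ->
  forall v, df v = dg v.
Proof.
intros Hf Hg v.
rewrite <- (is_derive_unique _ _ _ (diff_line_0 f z v df Hf)).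
exact (is_derive_unique _ _ _ (diff_line_0 f z v dg Hg)).
Qed.

Lemma diff_pair {W1 W2 : NormedModule R_AbsRing} (f : V -> W1) (g : V -> W2)
  (p : V) (df : V -> W1) (dg : V -> W2) :
  filterdiff f (locally p) df -> filterdiff g (locally p) dg ->
  filterdiff (V := prod_NormedModule R_AbsRing W1 W2)
    (fun x => (f x, g x)) (locally p) (fun v => (df v, dg v)).
Proof.
intros Hf Hg.
apply (filterdiff_comp'_2 (W := prod_NormedModule R_AbsRing W1 W2)
  f g (fun a b => (a, b)) p df dg (fun a b => (a, b)) Hf Hg).
apply (filterdiff_linear (V := prod_NormedModule R_AbsRing W1 W2)
  (fun t : prod_NormedModule R_AbsRing W1 W2 => (fst t, snd t))).
apply is_linear_prod; [apply is_linear_fst | apply is_linear_snd].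
Qed.

(** * Closure properties of functions of class C^n *)

Lemma Ck_on_ext (n : nat) (D : V -> Prop) (f g : V -> R) :
  open D -> (forall p, D p -> f p = g p) -> Ck_on n D f -> Ck_on n D g.
Proof.
(* Since [D] is open, agreement on [D] is agreement near each of its points; the differential of [f]
   then serves for [g] unchanged. *)
intros HD E; destruct n as [|n]; simpl.
- intros H p Hp.
  apply (continuous_ext_loc _ f); [|exact (H p Hp)].
  generalize (HD p Hp); apply filter_imp; exact E.
- intros [df [H1 H2]]; exists df; split; [|exact H2].
  intros p Hp; apply (filterdiff_ext_locally f); [|exact (H1 p Hp)].
  generalize (HD p Hp); apply filter_imp; exact E.
Qed.

Lemma Ck_on_continuous (n : nat) (D : V -> Prop) (f : V -> R) (p : V) :
  Ck_on n D f -> D p -> continuous f p.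
Proof.
destruct n as [|n]; simpl; [auto|].
intros [df [H _]] Hp.
exact (filterdiff_continuous f p (ex_intro _ (df p) (H p Hp))).
Qed.

Lemma Ck_on_S (n : nat) (D : V -> Prop) (f : V -> R) :
  Ck_on (S n) D f -> Ck_on n D f.
Proof.
revert f; induction n as [|n IH]; intros f H.
- intros p Hp; exact (Ck_on_continuous 1 D f p H Hp).
- destruct H as [df [H1 H2]]; exists df; split; [exact H1|].
  intros v; apply IH; exact (H2 v).
Qed.

Lemma Ck_on_sub (n : nat) (D D' : V -> Prop) (f : V -> R) :
  (forall p, D' p -> D p) -> Ck_on n D f -> Ck_on n D' f.
Proof.
intros E; revert f; induction n as [|n IH]; intros f; simpl; [auto|].
intros [df [H1 H2]]; exists df; split; auto.
Qed.

Lemma Ck_on_const (n : nat) (D : V -> Prop) (a : R) : Ck_on n D (fun _ => a).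
Proof.
revert a; induction n as [|n IH]; intros a.
- intros p _; apply continuous_const.
- exists (fun _ _ => 0); split; [intros p _; apply diff_const | intros v; apply IH].
Qed.

Lemma Ck_on_linear (n : nat) (D : V -> Prop) (l : V -> R) :
  is_linear l -> Ck_on n D l.
Proof.
intros H; destruct n as [|n].
- intros p _; exact (linear_cont l p H).
- exists (fun _ => l); split; [|intros v; apply Ck_on_const].
  intros p _; apply filterdiff_linear; exact H.
Qed.

Lemma Ck_on_plus (n : nat) (D : V -> Prop) (f g : V -> R) :
  Ck_on n D f -> Ck_on n D g -> Ck_on n D (fun p => f p + g p).
Proof.
revert f g; induction n as [|n IH]; intros f g Hf Hg.
- intros p Hp; exact (continuous_plus f g p (Hf p Hp) (Hg p Hp)).
- destruct Hf as [df [F1 F2]], Hg as [dg [G1 G2]].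
  exists (fun p v => df p v + dg p v); split.
  + intros p Hp; apply diff_plus; auto.
  + intros v; apply IH; auto.
Qed.

Lemma Ck_on_mult (n : nat) (D : V -> Prop) (f g : V -> R) :
  Ck_on n D f -> Ck_on n D g -> Ck_on n D (fun p => f p * g p).
Proof.
revert f g; induction n as [|n IH]; intros f g Hf Hg.
- intros p Hp; exact (continuous_mult f g p (Hf p Hp) (Hg p Hp)).
- assert (Hf' := Ck_on_S _ _ _ Hf); assert (Hg' := Ck_on_S _ _ _ Hg).
  destruct Hf as [df [F1 F2]], Hg as [dg [G1 G2]].
  exists (fun p v => df p v * g p + f p * dg p v); split.
  + intros p Hp; apply diff_mult; auto.
  + intros v; apply Ck_on_plus; apply IH; auto.
Qed.

Lemma Ck_on_opp (n : nat) (D : V -> Prop) (f : V -> R) :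
  Ck_on n D f -> Ck_on n D (fun p => - f p).
Proof.
intros H; replace (fun p => - f p) with (fun p => (-1) * f p).
- apply Ck_on_mult; [apply Ck_on_const | exact H].
- apply functional_extensionality; intros p; ring.
Qed.

Lemma Ck_on_minus (n : nat) (D : V -> Prop) (f g : V -> R) :
  Ck_on n D f -> Ck_on n D g -> Ck_on n D (fun p => f p - g p).
Proof. intros Hf Hg; apply Ck_on_plus; [|apply Ck_on_opp]; assumption. Qed.

(** One differentiation of a composite. [F] need only be differentiable at the values taken by [f],
    which covers [Rinv] and [ln]; the regularity of the new factor is left to the caller, who gets
    it by induction when [F'] is again expressed through [F]. *)
Lemma Ck_on_comp_S (n : nat) (D : V -> Prop) (F F' : R -> R) (f : V -> R) :
  (forall p, D p -> is_derive F (f p) (F' (f p))) ->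
  Ck_on (S n) D f -> Ck_on n D (fun p => F' (f p)) ->
  Ck_on (S n) D (fun p => F (f p)).
Proof.
intros HF [df [F1 F2]] HF'.
exists (fun p v => F' (f p) * df p v); split.
- intros p Hp; apply diff_comp; auto.
- intros v; apply Ck_on_mult; auto.
Qed.

Lemma Ck_on_comp_0 (D : V -> Prop) (F F' : R -> R) (f : V -> R) :
  (forall p, D p -> is_derive F (f p) (F' (f p))) ->
  Ck_on 0 D f -> Ck_on 0 D (fun p => F (f p)).
Proof.
intros HF Hf p Hp; apply (continuous_comp f F); [exact (Hf p Hp)|].
exact (ex_derive_continuous F (f p) (ex_intro _ _ (HF p Hp))).
Qed.

Lemma Ck_on_inv (n : nat) (D : V -> Prop) (f : V -> R) :
  (forall p, D p -> f p <> 0) -> Ck_on n D f -> Ck_on n D (fun p => / f p).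
Proof.
intros H; assert (HF : forall p, D p -> is_derive Rinv (f p) (- (/ f p * / f p))).
  intros p Hp; auto_derive; [exact (H p Hp) | field; exact (H p Hp)].
induction n as [|n IH]; intros Hf.
- exact (Ck_on_comp_0 D Rinv (fun x => - (/ x * / x)) f HF Hf).
- apply (Ck_on_comp_S n D Rinv (fun x => - (/ x * / x)) f HF Hf).
  apply Ck_on_opp, Ck_on_mult; apply IH, Ck_on_S; exact Hf.
Qed.

Lemma Ck_on_div (n : nat) (D : V -> Prop) (f g : V -> R) :
  (forall p, D p -> g p <> 0) -> Ck_on n D f -> Ck_on n D g ->
  Ck_on n D (fun p => f p / g p).
Proof. intros H Hf Hg; apply Ck_on_mult, Ck_on_inv; assumption. Qed.

Lemma Ck_on_ln (n : nat) (D : V -> Prop) (f : V -> R) :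
  (forall p, D p -> 0 < f p) -> Ck_on n D f -> Ck_on n D (fun p => ln (f p)).
Proof.
intros H Hf.
assert (HF : forall p, D p -> is_derive ln (f p) (/ f p)).
  intros p Hp; auto_derive; [exact (H p Hp) | apply Rmult_1_l].
destruct n as [|n]; [exact (Ck_on_comp_0 D ln Rinv f HF Hf)|].
apply (Ck_on_comp_S n D ln Rinv f HF Hf).
apply Ck_on_inv; [|apply Ck_on_S; exact Hf].
intros p Hp; generalize (H p Hp); lra.
Qed.

Lemma Ck_on_exp (n : nat) (D : V -> Prop) (f : V -> R) :
  Ck_on n D f -> Ck_on n D (fun p => exp (f p)).
Proof.
assert (HF : forall p, D p -> is_derive exp (f p) (exp (f p))).
  intros p _; apply is_derive_exp.
induction n as [|n IH]; intros Hf; [exact (Ck_on_comp_0 D exp exp f HF Hf)|].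
apply (Ck_on_comp_S n D exp exp f HF Hf), IH, Ck_on_S, Hf.
Qed.

(** The two claims are proved together because each function is, up to sign, the derivative of the
    other. *)
Lemma Ck_on_cos_sin (n : nat) (D : V -> Prop) (f : V -> R) : Ck_on n D f ->
  Ck_on n D (fun p => cos (f p)) /\ Ck_on n D (fun p => sin (f p)).
Proof.
assert (Hc : forall p, D p -> is_derive cos (f p) (- sin (f p))).
  intros p _; apply is_derive_cos.
assert (Hs : forall p, D p -> is_derive sin (f p) (cos (f p))).
  intros p _; apply is_derive_sin.
induction n as [|n IH]; intros Hf.
- split; [exact (Ck_on_comp_0 D cos (fun x => - sin x) f Hc Hf)|].
  exact (Ck_on_comp_0 D sin cos f Hs Hf).
- destruct (IH (Ck_on_S _ _ _ Hf)) as [IHc IHs]; split.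
  + apply (Ck_on_comp_S n D cos (fun x => - sin x) f Hc Hf), Ck_on_opp, IHs.
  + apply (Ck_on_comp_S n D sin cos f Hs Hf), IHc.
Qed.

End Calculus.

(** The differential of [l] is [l] at every point, so differentiating the composite only replaces
    the direction [v] by the fixed direction [l v], and the induction goes through. *)
Lemma Ck_on_comp_linear {V W : NormedModule R_AbsRing} (n : nat)
  (D : V -> Prop) (f : V -> R) (l : W -> V) :
  is_linear l -> Ck_on n D f -> Ck_on n (fun q => D (l q)) (fun q => f (l q)).
Proof.
intros Hl; revert f; induction n as [|n IH]; intros f Hf.
- intros q Hq; apply (continuous_comp l f); [|exact (Hf _ Hq)].
  exact (linear_cont l q Hl).
- destruct Hf as [df [F1 F2]].
  exists (fun q v => df (l q) (l v)); split.
  + intros q Hq; apply (filterdiff_comp' l f q l); [|exact (F1 _ Hq)].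
    apply filterdiff_linear, Hl.
  + intros v; exact (IH _ (F2 (l v))).
Qed.

Lemma continuous_pair {T A B : UniformSpace} (f : T -> A) (g : T -> B) (q : T) :
  continuous f q -> continuous g q ->
  continuous (U := prod_UniformSpace A B) (fun x => (f x, g x)) q.
Proof.
intros Hf Hg.
apply (continuous_comp_2 f g (fun x y => (x, y) : prod_UniformSpace A B) q Hf Hg).
apply (continuous_ext (U := prod_UniformSpace A B)
  (fun x : prod_UniformSpace A B => x)); [|apply continuous_id].
intros [x y]; reflexivity.
Qed.

(** * Symmetry of second derivatives *)

Section Second_derivatives.

Context {V : NormedModule R_AbsRing}.

Lemma continuous_affine_2 (z v w : V) (xy : R * R) :
  @continuous (prod_UniformSpace R_UniformSpace R_UniformSpace) V
    (fun u => plus (plus z (scal (fst u) v)) (scal (snd u) w)) xy.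
Proof.
apply (continuous_plus (U := prod_UniformSpace R_UniformSpace R_UniformSpace)
  (fun u => plus z (scal (fst u) v)) (fun u => scal (snd u) w)).
- apply (continuous_plus (U := prod_UniformSpace R_UniformSpace R_UniformSpace)
    (fun _ => z) (fun u => scal (fst u) v)); [apply continuous_const|].
  apply (continuous_scal_l
    (U := prod_UniformSpace R_UniformSpace R_UniformSpace) fst v).
  apply continuous_fst.
- apply (continuous_scal_l
    (U := prod_UniformSpace R_UniformSpace R_UniformSpace) snd w).
  apply continuous_snd.
Qed.

Lemma plus_scal_swap (z v w : V) (x y : R) :
  plus (plus z (scal x v)) (scal y w) = plus (plus z (scal y w)) (scal x v).
Proof. rewrite <- !plus_assoc; f_equal; apply plus_comm. Qed.

(** Schwarz's theorem for the restriction of [f] to the affine plane through [z] spanned by [v] and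
    [w]. The differential is a parameter so that [tau_closed] can supply the explicit one of
    [z_m]. *)
Lemma second_derivative_sym (D : V -> Prop) (f : V -> R) (df : V -> V -> R)
  (v w z : V) : open D ->
  (forall p, D p -> filterdiff f (locally p) (df p)) ->
  Ck_on 1 D (fun p => df p v) -> Ck_on 1 D (fun p => df p w) -> D z ->
  Derive (fun s => df (plus z (scal s v)) w) 0 =
  Derive (fun s => df (plus z (scal s w)) v) 0.
Proof.
intros HD Hf [dv [Hv Cv]] [dw [Hw Cw]] Hz.
pose (P := fun x y : R => plus (plus z (scal x v)) (scal y w)).
assert (P0 : P 0 0 = z) by (unfold P; rewrite !plus_scal_0; reflexivity).
assert (cP : forall x y, filterlim (fun u : R * R => P (fst u) (snd u))
    (locally (x, y)) (locally (P x y))).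
  intros x y; exact (continuous_affine_2 z v w (x, y)).
assert (HP : forall x y, D (P x y) -> locally_2d (fun a b => D (P a b)) x y).
  intros x y Hxy; apply locally_2d_locally; exact (cP x y D (HD _ Hxy)).
assert (line2 : forall g (dg : V -> R) x y, filterdiff g (locally (P x y)) dg ->
    is_derive (fun t => g (P x t)) y (dg w)).
  intros g dg x y Hg; exact (diff_line g (plus z (scal x v)) w y dg Hg).
assert (line1 : forall g (dg : V -> R) x y, filterdiff g (locally (P x y)) dg ->
    is_derive (fun t => g (P t y)) x (dg v)).
  intros g dg x y Hg.
  apply (is_derive_ext (fun t => g (plus (plus z (scal y w)) (scal t v)))).
    intros t; unfold P; rewrite plus_scal_swap; reflexivity.
  apply diff_line; rewrite <- plus_scal_swap; exact Hg.
assert (near1 : forall x y, D (P x y) -> locally x (fun t => D (P t y))).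
  intros x y Hxy; destruct (HP x y Hxy) as [e He]; exists e; intros t Ht.
  apply He; [exact Ht | rewrite Rminus_diag, Rabs_R0; apply cond_pos].
assert (near2 : forall x y, D (P x y) -> locally y (fun t => D (P x t))).
  intros x y Hxy; destruct (HP x y Hxy) as [e He]; exists e; intros t Ht.
  apply He; [rewrite Rminus_diag, Rabs_R0; apply cond_pos | exact Ht].
assert (mixed1 : forall x y, D (P x y) ->
    is_derive (fun a => Derive (fun t => f (P a t)) y) x (dw (P x y) v)).
  intros x y Hxy; apply (is_derive_ext_loc (fun a => df (P a y) w)).
    generalize (near1 x y Hxy); apply filter_imp; intros a Ha; symmetry.
    apply is_derive_unique, line2, Hf, Ha.
  apply (line1 (fun p => df p w)), Hw, Hxy.
assert (mixed2 : forall x y, D (P x y) ->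
    is_derive (fun b => Derive (fun t => f (P t b)) x) y (dv (P x y) w)).
  intros x y Hxy; apply (is_derive_ext_loc (fun b => df (P x b) v)).
    generalize (near2 x y Hxy); apply filter_imp; intros b Hb; symmetry.
    apply is_derive_unique, line1, Hf, Hb.
  apply (line2 (fun p => df p v)), Hv, Hxy.
assert (D0 : D (P 0 0)) by (rewrite P0; exact Hz).
assert (cont : forall g, (forall p, D p -> continuous g p) ->
    continuity_2d_pt (fun x y => g (P x y)) 0 0).
  intros g Hg; apply continuity_2d_pt_filterlim.
  exact (filterlim_comp _ _ _ (fun u : R * R => P (fst u) (snd u)) g _ _ _
    (cP 0 0) (Hg _ D0)).
transitivity (dw z v).
  apply is_derive_unique.
  apply (diff_line_0 (fun p => df p w)), Hw, Hz.
transitivity (dv z w).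
  rewrite <- P0.
  rewrite <- (is_derive_unique _ _ _ (mixed1 0 0 D0)).
  rewrite <- (is_derive_unique _ _ _ (mixed2 0 0 D0)).
  apply (Schwarz (fun x y => f (P x y)) 0 0).
  - generalize (HP 0 0 D0); apply locally_2d_impl, locally_2d_forall.
    intros x y Hxy; split; [|split; [|split]].
    + exists (df (P x y) v); apply line1, Hf, Hxy.
    + exists (df (P x y) w); apply line2, Hf, Hxy.
    + exists (dw (P x y) v); apply mixed1, Hxy.
    + exists (dv (P x y) w); apply mixed2, Hxy.
  - apply (continuity_2d_pt_ext_loc (fun x y => dw (P x y) v)).
      generalize (HP 0 0 D0); apply locally_2d_impl, locally_2d_forall.
      intros x y Hxy; symmetry; apply is_derive_unique, mixed1, Hxy.
    apply (cont (fun p => dw p v)), Cw.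
  - apply (continuity_2d_pt_ext_loc (fun x y => dv (P x y) w)).
      generalize (HP 0 0 D0); apply locally_2d_impl, locally_2d_forall.
      intros x y Hxy; symmetry; apply is_derive_unique, mixed2, Hxy.
    apply (cont (fun p => dv p w)), Cv.
symmetry; apply is_derive_unique.
apply (diff_line_0 (fun p => df p v)), Hv, Hz.
Qed.

(** A canonical choice for the differentials that [Ck_on] only asserts to exist. It is total, hence
    can be iterated, and the two terms of [ext_d] are instances of it by conversion. *)
Definition grad (f : V -> R) (p v : V) : R :=
  Derive (fun s => f (plus p (scal s v))) 0.

Lemma grad_eq (f : V -> R) (p : V) (df : V -> R) :
  filterdiff f (locally p) df -> forall v, grad f p v = df v.
Proof. intros H v; apply is_derive_unique, diff_line_0, H. Qed.

Lemma grad_filterdiff (D : V -> Prop) (n : nat) (f : V -> R) (p : V) :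
  Ck_on (S n) D f -> D p -> filterdiff f (locally p) (grad f p).
Proof.
intros [df [H _]] Hp; apply (diff_ext_lin _ _ (df p)); [exact (H p Hp)|].
intros v; symmetry; apply grad_eq, H, Hp.
Qed.

Lemma grad_Ck (D : V -> Prop) (n : nat) (f : V -> R) (v : V) :
  open D -> Ck_on (S n) D f -> Ck_on n D (fun p => grad f p v).
Proof.
intros HD [df [H1 H2]]; apply (Ck_on_ext n D (fun p => df p v)); auto.
intros p Hp; symmetry; apply grad_eq, H1, Hp.
Qed.

Lemma grad_sym (D : V -> Prop) (f : V -> R) (v w z : V) : open D ->
  Ck_on 2 D f -> D z ->
  grad (fun p => grad f p w) z v = grad (fun p => grad f p v) z w.
Proof.
intros HD Hf Hz; apply (second_derivative_sym D f (grad f)); auto.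
- intros p Hp; exact (grad_filterdiff D 1 f p Hf Hp).
- apply grad_Ck; assumption.
- apply grad_Ck; assumption.
Qed.

End Second_derivatives.

(** * Expansion in coordinates *)

Lemma linear_R4 (l : R4 -> R) : is_linear l -> forall v : R4,
  l v = fst (fst v) * l ((1, 0), (0, 0)) + snd (fst v) * l ((0, 1), (0, 0)) +
        fst (snd v) * l ((0, 0), (1, 0)) + snd (snd v) * l ((0, 0), (0, 1)).
Proof.
intros Hl [[a b] [x y]]; simpl.
assert (P := linear_plus l Hl); assert (Q := linear_scal l Hl).
rewrite <- (Q a ((1, 0), (0, 0)) : l (scal a _) = a * l _).
rewrite <- (Q b ((0, 1), (0, 0)) : l (scal b _) = b * l _).
rewrite <- (Q x ((0, 0), (1, 0)) : l (scal x _) = x * l _).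
rewrite <- (Q y ((0, 0), (0, 1)) : l (scal y _) = y * l _).
rewrite <- (P _ _ : l (plus _ _) = l _ + l _).
rewrite <- (P _ _ : l (plus _ _) = l _ + l _).
rewrite <- (P _ _ : l (plus _ _) = l _ + l _).
f_equal; apply injective_projections; apply injective_projections; simpl;
  unfold plus, scal; simpl; unfold mult; simpl; ring.
Qed.

(** The chain rule is written with four partial derivatives, because the induction hypothesis
    applies to [df] only in a fixed direction; [linear_R4] identifies this sum with the differential
    of the composite. *)
Lemma Ck_on_comp_R4 {W : NormedModule R_AbsRing} (n : nat) (D : R4 -> Prop)
  (D' : W -> Prop) (f : R4 -> R) (g1 g2 g3 g4 : W -> R) :
  Ck_on n D f ->
  Ck_on n D' g1 -> Ck_on n D' g2 -> Ck_on n D' g3 -> Ck_on n D' g4 ->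
  (forall q, D' q -> D ((g1 q, g2 q), (g3 q, g4 q))) ->
  Ck_on n D' (fun q => f ((g1 q, g2 q), (g3 q, g4 q))).
Proof.
revert f g1 g2 g3 g4; induction n as [|n IH];
  intros f g1 g2 g3 g4 Hf H1 H2 H3 H4 HD.
- intros q Hq.
  apply (continuous_comp (V := R4)
    (fun q => ((g1 q, g2 q), (g3 q, g4 q))) f); [|exact (Hf _ (HD q Hq))].
  apply (continuous_pair (A := R2) (B := R2) (fun q => (g1 q, g2 q))
    (fun q => (g3 q, g4 q)));
    apply continuous_pair; auto.
- assert (Hf' := Ck_on_S _ _ _ Hf).
  assert (H1' := Ck_on_S _ _ _ H1); assert (H2' := Ck_on_S _ _ _ H2).
  assert (H3' := Ck_on_S _ _ _ H3); assert (H4' := Ck_on_S _ _ _ H4).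
  destruct Hf as [df [F1 F2]], H1 as [d1 [A1 B1]], H2 as [d2 [A2 B2]],
    H3 as [d3 [A3 B3]], H4 as [d4 [A4 B4]].
  pose (G := fun q => ((g1 q, g2 q), (g3 q, g4 q)) : R4).
  exists (fun q v => d1 q v * df (G q) ((1, 0), (0, 0)) +
    d2 q v * df (G q) ((0, 1), (0, 0)) + d3 q v * df (G q) ((0, 0), (1, 0)) +
    d4 q v * df (G q) ((0, 0), (0, 1))).
  split.
  + intros q Hq; assert (HF := F1 _ (HD q Hq)).
    apply (diff_ext_lin _ _ (fun v => df (G q) ((d1 q v, d2 q v), (d3 q v, d4 q v)))).
      apply (filterdiff_comp' (V := R4) G f q
        (fun v => ((d1 q v, d2 q v), (d3 q v, d4 q v))) (df (G q))); [|exact HF].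
      apply (diff_pair (W1 := R2) (W2 := R2) (fun q => (g1 q, g2 q))
        (fun q => (g3 q, g4 q))); apply diff_pair; auto.
    intros v; rewrite (linear_R4 _ (proj1 HF)); reflexivity.
  + intros v; repeat apply Ck_on_plus; apply Ck_on_mult; auto.
    * apply (IH (fun p => df p ((1, 0), (0, 0)))); auto.
    * apply (IH (fun p => df p ((0, 1), (0, 0)))); auto.
    * apply (IH (fun p => df p ((0, 0), (1, 0)))); auto.
    * apply (IH (fun p => df p ((0, 0), (0, 1)))); auto.
Qed.

(** The plane is the first factor of [R4]; the other two coordinates are filled with 0 to reuse the
    four-variable chain rule. *)
Lemma Ck_on_comp_R2 {W : NormedModule R_AbsRing} (n : nat) (D : R2 -> Prop)
  (D' : W -> Prop) (f : R2 -> R) (g1 g2 : W -> R) :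
  Ck_on n D f -> Ck_on n D' g1 -> Ck_on n D' g2 ->
  (forall q, D' q -> D (g1 q, g2 q)) ->
  Ck_on n D' (fun q => f (g1 q, g2 q)).
Proof.
intros Hf H1 H2 HD.
apply (Ck_on_comp_R4 n (fun p => D (fst p)) D' (fun p => f (fst p))
  g1 g2 (fun _ => 0) (fun _ => 0)); auto using Ck_on_const.
apply (Ck_on_comp_linear (V := R2) (W := R4) n D f fst); [|exact Hf].
apply is_linear_fst.
Qed.

(** * Logarithm and argument *)

(* [ring] and [field] treat [fst] at the carriers [R2] and [C], which are only
   convertible, as different functions. *)
Ltac unfold_sorts :=
  change (NormedModule.sort R_AbsRing R2) with C in *;
  change (NormedModule.sort R_AbsRing R_NormedModule) with R in *.

Lemma R2_linear_eq (l : R2 -> R) : is_linear l -> forall v : R2,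
  l v = fst v * l (1, 0) + snd v * l (0, 1).
Proof.
intros Hl [a b]; simpl.
rewrite <- (linear_scal l Hl a (1, 0) : l (scal a _) = a * l _).
rewrite <- (linear_scal l Hl b (0, 1) : l (scal b _) = b * l _).
rewrite <- (linear_plus l Hl _ _ : l (plus _ _) = l _ + l _).
f_equal; apply injective_projections; simpl;
  unfold plus, scal; simpl; unfold mult; simpl; ring.
Qed.

Lemma is_linear_R2_fst : is_linear (fst : R2 -> R).
Proof. exact (is_linear_fst (U := R_NormedModule) (V := R_NormedModule)). Qed.

Lemma is_linear_R2_snd : is_linear (snd : R2 -> R).
Proof. exact (is_linear_snd (U := R_NormedModule) (V := R_NormedModule)). Qed.

Lemma is_linear_R4_fst : is_linear (fst : R4 -> R2).
Proof. exact (is_linear_fst (U := R2) (V := R2)). Qed.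

Lemma is_linear_R4_snd : is_linear (snd : R4 -> R2).
Proof. exact (is_linear_snd (U := R2) (V := R2)). Qed.

Lemma Ck_on_R2_fst (n : nat) (D : R2 -> Prop) : Ck_on n D (fun c => fst c).
Proof. apply (Ck_on_linear n D (fst : R2 -> R)), is_linear_R2_fst. Qed.

Lemma Ck_on_R2_snd (n : nat) (D : R2 -> Prop) : Ck_on n D (fun c => snd c).
Proof. apply (Ck_on_linear n D (snd : R2 -> R)), is_linear_R2_snd. Qed.

Lemma Ck_on_comp_fst (n : nat) (D : R2 -> Prop) (f : R2 -> R) :
  Ck_on n D f -> Ck_on (V := R4) n (fun p => D (fst p)) (fun p => f (fst p)).
Proof.
apply (Ck_on_comp_linear (V := R2) (W := R4) n D f fst), is_linear_R4_fst.
Qed.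

Lemma Ck_on_comp_snd (n : nat) (D : R2 -> Prop) (f : R2 -> R) :
  Ck_on n D f -> Ck_on (V := R4) n (fun p => D (snd p)) (fun p => f (snd p)).
Proof.
apply (Ck_on_comp_linear (V := R2) (W := R4) n D f snd), is_linear_R4_snd.
Qed.

Lemma Ck_on_R4_coords (n : nat) (D : R4 -> Prop) :
  (Ck_on n D (fun p => fst (fst p)) /\ Ck_on n D (fun p => snd (fst p))) /\
  (Ck_on n D (fun p => fst (snd p)) /\ Ck_on n D (fun p => snd (snd p))).
Proof.
repeat split; apply (Ck_on_sub n (fun _ => True)); auto.
- apply (Ck_on_comp_fst n (fun _ => True) fst), Ck_on_R2_fst.
- apply (Ck_on_comp_fst n (fun _ => True) snd), Ck_on_R2_snd.
- apply (Ck_on_comp_snd n (fun _ => True) fst), Ck_on_R2_fst.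
- apply (Ck_on_comp_snd n (fun _ => True) snd), Ck_on_R2_snd.
Qed.

Lemma diff_R2_fst (c : R2) : filterdiff (fun x : R2 => fst x) (locally c) fst.
Proof. apply (filterdiff_linear (fst : R2 -> R)), is_linear_R2_fst. Qed.

Lemma diff_R2_snd (c : R2) : filterdiff (fun x : R2 => snd x) (locally c) snd.
Proof. apply (filterdiff_linear (snd : R2 -> R)), is_linear_R2_snd. Qed.

Lemma diff_comp_fst {W : NormedModule R_AbsRing} (f : R2 -> W) (p : R4)
  (df : R2 -> W) : filterdiff f (locally (fst p : R2)) df ->
  filterdiff (fun q : R4 => f (fst q)) (locally p) (fun v => df (fst v)).
Proof.
apply (filterdiff_comp' (fst : R4 -> R2) f p fst df).
apply filterdiff_linear, is_linear_R4_fst.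
Qed.

Lemma diff_comp_snd {W : NormedModule R_AbsRing} (f : R2 -> W) (p : R4)
  (df : R2 -> W) : filterdiff f (locally (snd p : R2)) df ->
  filterdiff (fun q : R4 => f (snd q)) (locally p) (fun v => df (snd v)).
Proof.
apply (filterdiff_comp' (snd : R4 -> R2) f p snd df).
apply filterdiff_linear, is_linear_R4_snd.
Qed.

Lemma diff_slice_1 (f : R2 -> R) (x y : R) (df : R2 -> R) :
  filterdiff f (locally ((x, y) : R2)) df ->
  is_derive (fun s => f (s, y)) x (df (1, 0)).
Proof.
assert (E : forall s : R, plus ((0, y) : R2) (scal s ((1, 0) : R2)) = (s, y)).
  intros s; apply injective_projections; simpl; unfold plus, scal; simpl;
    unfold mult; simpl; ring.
intros H; apply (is_derive_ext (fun s => f (plus (0, y) (scal s (1, 0))))).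
  intros s; rewrite E; reflexivity.
apply (diff_line f (0, y) (1, 0) x df); rewrite E; exact H.
Qed.

Lemma diff_slice_2 (f : R2 -> R) (x y : R) (df : R2 -> R) :
  filterdiff f (locally ((x, y) : R2)) df ->
  is_derive (fun s => f (x, s)) y (df (0, 1)).
Proof.
assert (E : forall s : R, plus ((x, 0) : R2) (scal s ((0, 1) : R2)) = (x, s)).
  intros s; apply injective_projections; simpl; unfold plus, scal; simpl;
    unfold mult; simpl; ring.
intros H; apply (is_derive_ext (fun s => f (plus (x, 0) (scal s (0, 1))))).
  intros s; rewrite E; reflexivity.
apply (diff_line f (x, 0) (0, 1) y df); rewrite E; exact H.
Qed.

(** The square of [Cmod c], without the root: with it, the differentials of ln|c| and arg c are
    rational and within reach of [field]. *)
Definition sqnorm (c : C) : R := fst c * fst c + snd c * snd c.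

Lemma sqnorm_pos (c : C) : c <> RtoC 0 -> 0 < sqnorm c.
Proof.
intros H; destruct c as [a b]; unfold sqnorm; simpl.
destruct (Req_dec a 0) as [-> | Ha]; [|nra].
destruct (Req_dec b 0) as [-> | Hb]; [|nra].
exfalso; apply H; reflexivity.
Qed.

Lemma ln_Cmod (c : C) : c <> RtoC 0 -> ln (Cmod c) = / 2 * ln (sqnorm c).
Proof.
intros H; assert (P := proj1 (Cmod_gt_0 c) H).
replace (sqnorm c) with (Cmod c * Cmod c); [rewrite ln_mult by assumption; field|].
unfold Cmod; rewrite sqrt_sqrt; [unfold sqnorm; ring | nra].
Qed.

Lemma open_nonzero : open (fun c : R2 => c <> RtoC 0).
Proof.
apply (open_ext (T := R2) (fun c => fst c <> 0 \/ snd c <> 0)).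
- intros [a b]; simpl; split.
  + intros H E; inversion E; tauto.
  + intros H; destruct (Req_dec a 0) as [-> | Ha]; [right | left; exact Ha].
    intros ->; apply H; reflexivity.
- apply (open_or (T := R2)).
  + apply (open_comp (T := R2) (fst : R2 -> R) (fun x : R => x <> 0));
      [|apply open_neq].
    intros c _; exact (linear_cont (fst : R2 -> R) c is_linear_R2_fst).
  + apply (open_comp (T := R2) (snd : R2 -> R) (fun x : R => x <> 0));
      [|apply open_neq].
    intros c _; exact (linear_cont (snd : R2 -> R) c is_linear_R2_snd).
Qed.

Lemma Ck_on_sqnorm (n : nat) (D : R2 -> Prop) : Ck_on n D sqnorm.
Proof.
apply Ck_on_plus; apply Ck_on_mult; apply Ck_on_R2_fst || apply Ck_on_R2_snd.
Qed.

Lemma diff_sqnorm (c : R2) : filterdiff (sqnorm : R2 -> R) (locally c)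
  (fun v : R2 => 2 * (fst c * fst v + snd c * snd v)).
Proof.
apply (diff_ext_lin _ _ (fun v : R2 => (fst v * fst c + fst c * fst v) +
  (snd v * snd c + snd c * snd v))); [|intros v; ring].
apply diff_plus; apply diff_mult; apply diff_R2_fst || apply diff_R2_snd.
Qed.

Lemma locally_nonzero (c : R2) (P : R2 -> Prop) : c <> RtoC 0 ->
  (forall x, x <> RtoC 0 -> P x) -> locally c P.
Proof. intros Hc H; generalize (open_nonzero c Hc); apply filter_imp; exact H. Qed.

Lemma Ck_on_ln_Cmod (n : nat) :
  Ck_on (V := R2) n (fun c => c <> RtoC 0) (fun c => ln (Cmod c)).
Proof.
apply (Ck_on_ext n _ (fun c => / 2 * ln (sqnorm c))); [apply open_nonzero | |].
- intros c Hc; symmetry; apply ln_Cmod, Hc.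
- apply Ck_on_mult; [apply Ck_on_const | apply Ck_on_ln, Ck_on_sqnorm].
  apply sqnorm_pos.
Qed.

Lemma diff_ln_Cmod (c : R2) : c <> RtoC 0 ->
  filterdiff (fun c : R2 => ln (Cmod c)) (locally c)
    (fun v : R2 => (fst c * fst v + snd c * snd v) / sqnorm c).
Proof.
intros Hc; assert (P := sqnorm_pos c Hc).
apply (filterdiff_ext_locally (fun c : R2 => / 2 * ln (sqnorm c))).
  apply locally_nonzero; [exact Hc|]; intros x Hx; symmetry; apply ln_Cmod, Hx.
apply (diff_ext_lin _ _ (fun v : R2 => 0 * ln (sqnorm c) +
  / 2 * (/ sqnorm c * (2 * (fst c * fst v + snd c * snd v))))).
  refine (diff_mult (fun _ : R2 => / 2) (fun c : R2 => ln (sqnorm c)) c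
    (fun _ => 0) _ (diff_const _ _) _).
  apply (diff_comp ln); [|apply diff_sqnorm].
  auto_derive; [exact P | apply Rmult_1_l].
intros v; field; lra.
Qed.

Section Branch_of_arg.

Variables (U : C -> Prop) (arg : C -> R).
Hypothesis U_open : open (T := C_UniformSpace) U.
Hypothesis U_nonzero : forall c, U c -> c <> RtoC 0.
Hypothesis arg_U : arg_branch U arg.

(* tan (arg x - arg c) is a rational function of x. *)
Lemma arg_near (c : C) : U c -> locally (c : R2) (fun x => arg x =
  arg c + atan ((fst c * snd x - snd c * fst x) /
                (fst c * fst x + snd c * snd x))).
Proof.
intros Hc; destruct (arg_U c Hc) as [Cc Ec].
(* The radius 1 is below pi / 2 ([PI2_1]), so the difference of the two arguments has positive
   cosine and [atan] undoes [tan]. *)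
assert (N : locally (c : R2) (fun x => Rabs (arg x - arg c) < 1)).
  refine (Cc (fun t => Rabs (t - arg c) < 1) _).
  exists (mkposreal 1 Rlt_0_1); intros y Hy; exact Hy.
generalize (filter_and _ _ N (U_open c Hc)); apply filter_imp.
intros x [Hx Ux]; destruct (arg_U x Ux) as [_ Ex].
apply Rabs_def2 in Hx.
assert (Pc := proj1 (Cmod_gt_0 c) (U_nonzero c Hc)).
assert (Px := proj1 (Cmod_gt_0 x) (U_nonzero x Ux)).
set (r := Cmod c) in *; set (q := Cmod x) in *.
set (s := arg c) in *; set (t := arg x) in *.
assert (Hd : 0 < cos (t - s)).
  apply cos_gt_0; generalize PI2_1; lra.
rewrite Ec, Ex; unfold cexp; simpl; rewrite !exp_0.
replace (_ / _) with (tan (t - s)).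
  rewrite atan_tan; [ring | generalize PI2_1; lra].
unfold tan; rewrite cos_minus in Hd; rewrite sin_minus, cos_minus.
field; split; [|nra].
replace (_ + _) with (r * q * (cos t * cos s + sin t * sin s)) by ring.
apply Rgt_not_eq; apply Rmult_lt_0_compat; nra.
Qed.

Lemma diff_arg (c : R2) : U c -> filterdiff (arg : R2 -> R) (locally c)
  (fun v : R2 => (fst c * snd v - snd c * fst v) / sqnorm c).
Proof.
intros Hc; assert (P := sqnorm_pos c (U_nonzero c Hc)).
apply (filterdiff_ext_locally (fun x : R2 => arg c +
  atan ((fst c * snd x - snd c * fst x) / (fst c * fst x + snd c * snd x)))).
  generalize (arg_near c Hc); apply filter_imp; intros x Hx; symmetry; exact Hx.
assert (L : forall a (g : R2 -> R), filterdiff g (locally c) g ->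
    filterdiff (fun x : R2 => a * g x) (locally c) (fun v => a * g v)).
  intros a g Hg; apply (diff_ext_lin _ _ (fun v : R2 => 0 * g c + a * g v)).
    apply diff_mult; [apply diff_const | exact Hg].
  intros v; ring.
(* The argument of [atan] vanishes at [c], so the outer derivative is 1 and only the differential of
   the numerator survives. *)
apply (diff_ext_lin _ _ (fun v : R2 => 0 + / (1 +
  ((fst c * snd c - snd c * fst c) / (fst c * fst c + snd c * snd c)) ^ 2) *
  (((fst c * snd v - snd c * fst v) * (fst c * fst c + snd c * snd c) -
    (fst c * snd c - snd c * fst c) * (fst c * fst v + snd c * snd v)) /
  ((fst c * fst c + snd c * snd c) * (fst c * fst c + snd c * snd c))))).
- apply diff_plus; [apply diff_const|].
  apply (diff_comp atan).
    apply <- is_derive_Reals; apply derivable_pt_lim_atan.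
  apply (diff_div (fun x : R2 => fst c * snd x - snd c * fst x)
    (fun x : R2 => fst c * fst x + snd c * snd x) c
    (fun v : R2 => fst c * snd v - snd c * fst v)
    (fun v : R2 => fst c * fst v + snd c * snd v)).
  + apply Rgt_not_eq; exact P.
  + apply diff_minus; apply L; auto; apply diff_R2_fst || apply diff_R2_snd.
  + apply diff_plus; apply L; auto; apply diff_R2_fst || apply diff_R2_snd.
- intros v; unfold sqnorm in *.
  replace (fst c * snd c - snd c * fst c) with 0 by ring.
  field; lra.
Qed.

Lemma Ck_on_arg (n : nat) : Ck_on (V := R2) n U arg.
Proof.
(* Proving one order more covers n = 0 as well. The differential is a rational function of [c] in
   which [arg] no longer occurs. *)
assert (H : Ck_on (V := R2) (S n) U arg); [|apply Ck_on_S; exact H].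
exists (fun c (v : R2) => (fst c * snd v - snd c * fst v) / sqnorm c); split.
- exact diff_arg.
- intros v; apply Ck_on_div; [| |apply Ck_on_sqnorm].
  + intros c Hc; apply Rgt_not_eq, sqnorm_pos, U_nonzero, Hc.
  + apply Ck_on_minus; apply Ck_on_mult; auto using Ck_on_const.
    apply Ck_on_R2_fst. apply Ck_on_R2_snd.
Qed.

End Branch_of_arg.

(** * Regularity of the invariant S, of its partial derivatives and of the first period *)

Section Invariant.

Variable S : R2 -> R.
Hypothesis S_smooth : smooth_on (fun _ => True) S.

Lemma S1_grad (c : R2) : S1 S c = grad S c (1, 0).
Proof.
destruct c as [x y]; apply is_derive_unique, diff_slice_1.
exact (grad_filterdiff _ _ S (x, y) (S_smooth 1%nat) I).
Qed.

Lemma S2_grad (c : R2) : S2 S c = grad S c (0, 1).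
Proof.
destruct c as [x y]; apply is_derive_unique, diff_slice_2.
exact (grad_filterdiff _ _ S (x, y) (S_smooth 1%nat) I).
Qed.

Lemma diff_S (c : R2) : filterdiff S (locally c)
  (fun v : R2 => S1 S c * fst v + S2 S c * snd v).
Proof.
assert (H := grad_filterdiff _ _ S c (S_smooth 1%nat) I).
apply (diff_ext_lin _ _ _ _ H); intros v.
rewrite (R2_linear_eq _ (proj1 H)), S1_grad, S2_grad; ring.
Qed.

Lemma Ck_on_S1 (n : nat) : Ck_on (V := R2) n (fun _ => True) (S1 S).
Proof.
apply (Ck_on_ext n _ (fun c => grad S c (1, 0))); [apply open_true | |].
- intros c _; symmetry; apply S1_grad.
- apply grad_Ck; [apply open_true | exact (S_smooth _)].
Qed.

Lemma Ck_on_S2 (n : nat) : Ck_on (V := R2) n (fun _ => True) (S2 S).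
Proof.
apply (Ck_on_ext n _ (fun c => grad S c (0, 1))); [apply open_true | |].
- intros c _; symmetry; apply S2_grad.
- apply grad_Ck; [apply open_true | exact (S_smooth _)].
Qed.

Lemma Ck_on_period_1 (n : nat) :
  Ck_on (V := R2) n (fun c => c <> RtoC 0) (fun c => S1 S c - ln (Cmod c)).
Proof.
apply Ck_on_minus; [|apply Ck_on_ln_Cmod].
apply (Ck_on_sub n (fun _ => True)); [auto | apply Ck_on_S1].
Qed.

End Invariant.

(** * The parametrization and the action-angle functions *)

Section Complex_calculus.

Context {V : NormedModule R_AbsRing}.

Lemma diff_C_fst (f : V -> R2) (p : V) (df : V -> R2) :
  filterdiff f (locally p) df ->
  filterdiff (fun x => fst (f x)) (locally p) (fun v => fst (df v)).
Proof.
intros H; apply (filterdiff_comp' f (fst : R2 -> R) p df fst H).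
apply diff_R2_fst.
Qed.

Lemma diff_C_snd (f : V -> R2) (p : V) (df : V -> R2) :
  filterdiff f (locally p) df ->
  filterdiff (fun x => snd (f x)) (locally p) (fun v => snd (df v)).
Proof.
intros H; apply (filterdiff_comp' f (snd : R2 -> R) p df snd H).
apply diff_R2_snd.
Qed.

(** The differentials are real-linear maps into the plane, so each complex rule below is checked on
    real and imaginary parts. *)
Lemma diff_C_pair (f : V -> R2) (p : V) (df : V -> R2) (d1 d2 : V -> R) :
  filterdiff (fun x => fst (f x)) (locally p) d1 ->
  filterdiff (fun x => snd (f x)) (locally p) d2 ->
  (forall v, df v = (d1 v, d2 v)) -> filterdiff f (locally p) df.
Proof.
intros H1 H2 E.
apply (filterdiff_ext (V := R2) (fun x => (fst (f x), snd (f x)))).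
  intros x; symmetry; apply surjective_pairing.
apply (filterdiff_ext_lin (V := R2) _ (fun v => (d1 v, d2 v))).
  exact (diff_pair _ _ _ _ _ H1 H2).
intros v; symmetry; apply E.
Qed.

Lemma diff_C_mult (f g : V -> R2) (p : V) (df dg : V -> R2) :
  filterdiff f (locally p) df -> filterdiff g (locally p) dg ->
  filterdiff (fun x => Cmult (f x) (g x) : R2) (locally p)
    (fun v => Cplus (Cmult (df v) (g p)) (Cmult (f p) (dg v))).
Proof.
intros Hf Hg.
assert (F1 := diff_C_fst _ _ _ Hf); assert (F2 := diff_C_snd _ _ _ Hf).
assert (G1 := diff_C_fst _ _ _ Hg); assert (G2 := diff_C_snd _ _ _ Hg).
eapply diff_C_pair;
  [exact (diff_minus _ _ _ _ _ (diff_mult _ _ _ _ _ F1 G1)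
     (diff_mult _ _ _ _ _ F2 G2))
  |exact (diff_plus _ _ _ _ _ (diff_mult _ _ _ _ _ F1 G2)
     (diff_mult _ _ _ _ _ F2 G1))|].
intros v; unfold Cplus, Cmult; simpl.
apply injective_projections; simpl; ring.
Qed.

Lemma diff_C_exp (f : V -> R2) (p : V) (df : V -> R2) :
  filterdiff f (locally p) df ->
  filterdiff (fun x => cexp (f x) : R2) (locally p)
    (fun v => Cmult (cexp (f p)) (df v)).
Proof.
intros Hf.
assert (E := diff_comp exp _ _ _ _ (is_derive_exp _) (diff_C_fst _ _ _ Hf)).
assert (F2 := diff_C_snd _ _ _ Hf).
assert (Fc := diff_comp cos _ _ _ _ (is_derive_cos _) F2).
assert (Fs := diff_comp sin _ _ _ _ (is_derive_sin _) F2).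
eapply diff_C_pair;
  [exact (diff_mult _ _ _ _ _ E Fc) | exact (diff_mult _ _ _ _ _ E Fs)|].
intros v; unfold Cmult, cexp; simpl.
apply injective_projections; simpl; ring.
Qed.

Lemma diff_C_inv (f : V -> R2) (p : V) (df : V -> R2) : f p <> RtoC 0 ->
  filterdiff f (locally p) df ->
  filterdiff (fun x => Cinv (f x) : R2) (locally p)
    (fun v => Copp (Cmult (df v) (Cinv (Cmult (f p) (f p))))).
Proof.
intros H Hf; assert (P := sqnorm_pos _ H); unfold sqnorm in P.
assert (F1 := diff_C_fst _ _ _ Hf); assert (F2 := diff_C_snd _ _ _ Hf).
assert (N : fst (f p) * fst (f p) + snd (f p) * snd (f p) <> 0) by lra.
assert (F3 := diff_plus _ _ _ _ _ (diff_mult _ _ _ _ _ F1 F1)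
  (diff_mult _ _ _ _ _ F2 F2)).
apply (filterdiff_ext (V := R2) (fun x =>
  (fst (f x) / (fst (f x) * fst (f x) + snd (f x) * snd (f x)),
   - snd (f x) / (fst (f x) * fst (f x) + snd (f x) * snd (f x))))).
  intros x; unfold Cinv; apply injective_projections; simpl; rewrite !Rmult_1_r;
    reflexivity.
eapply diff_C_pair;
  [exact (diff_div _ _ _ _ _ N F1 F3)
  |exact (diff_div _ _ _ _ _ N (diff_opp _ _ _ F2) F3)|].
intros v; unfold Copp, Cmult, Cinv.
generalize dependent (f p); intros [a b]; generalize (df v); intros [c d].
simpl; intros.
(* The squared modulus of the square of a + i b, which is the denominator in the inverse of that
   square. *)
assert (Q : a * a * (a * a) + 2 * (a * a) * (b * b) + b * b * (b * b) <> 0).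
  replace (_ + _) with ((a * a + b * b) * (a * a + b * b)) by ring; nra.
apply injective_projections; simpl; field; split; try assumption; nra.
Qed.

End Complex_calculus.

Lemma Tpar_formula (c : C) (t1 t2 : R) :
  Tpar (c, (t1, t2)) = (Cmult c (cexp (- t1, t2)), cexp (t1, - t2)).
Proof.
unfold Tpar, phi1, phi2, Gamma; simpl.
apply injective_projections; cbn [fst snd].
- rewrite Cmult_assoc, <- cexp_plus, Cmult_comm; f_equal; f_equal.
  apply injective_projections; simpl; ring.
- rewrite Cmult_1_r, <- cexp_plus; f_equal.
  apply injective_projections; simpl; ring.
Qed.

Lemma Tpar_eq (p : C * C) : Tpar p =
  (Cmult (fst p) (cexp (- fst (snd p), snd (snd p))),
   cexp (fst (snd p), - snd (snd p))).
Proof. destruct p as [c [t1 t2]]; apply Tpar_formula. Qed.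

Lemma pi_can_Tpar (p : C * C) : pi_can (Tpar p) = fst p.
Proof.
rewrite Tpar_eq; unfold pi_can; simpl.
rewrite <- Cmult_assoc, (Cmult_comm (cexp _)), cexp_cancel; apply Cmult_1_r.
Qed.

(** [dt] is the variation of t1 - i t2, the exponent of z_2; the exponential in z_1 has the opposite
    exponent. *)
Definition dTpar (p v : C * C) : C * C :=
  let E := cexp (fst (snd p), - snd (snd p)) in
  let E' := cexp (- fst (snd p), snd (snd p)) in
  let dt := (fst (snd v), - snd (snd v)) : C in
  (Cplus (Cmult (fst v) E') (Cmult (fst p) (Cmult E' (Copp dt))), Cmult E dt).

Lemma diff_Tpar (p : R4) :
  filterdiff (Tpar : R4 -> R4) (locally p) (dTpar p).
Proof.
apply (filterdiff_ext (V := R4) (fun p : R4 =>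
  (Cmult (fst p) (cexp (- fst (snd p), snd (snd p))),
   cexp (fst (snd p), - snd (snd p))))).
  intros x; symmetry; apply Tpar_eq.
assert (T1 := diff_comp_snd _ p _ (diff_R2_fst (snd p))).
assert (T2 := diff_comp_snd _ p _ (diff_R2_snd (snd p))).
assert (T := diff_pair _ _ _ _ _ T1 (diff_opp _ _ _ T2)).
assert (T' := diff_pair _ _ _ _ _ (diff_opp _ _ _ T1) T2).
assert (Hc := filterdiff_linear (F := locally p) _ is_linear_R4_fst).
apply (filterdiff_ext_lin (V := R4) _ (fun v : R4 =>
  (Cplus (Cmult (fst v) (cexp (- fst (snd p), snd (snd p))))
     (Cmult (fst p) (Cmult (cexp (- fst (snd p), snd (snd p)))
       (- fst (snd v), snd (snd v)))),
   Cmult (cexp (fst (snd p), - snd (snd p))) (fst (snd v), - snd (snd v))))).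
- apply (diff_pair (W1 := R2) (W2 := R2)).
  + exact (diff_C_mult _ _ _ _ _ Hc (diff_C_exp _ _ _ T')).
  + exact (diff_C_exp _ _ _ T).
- intros v; unfold dTpar, Copp; cbn [fst snd]; rewrite Ropp_involutive.
  reflexivity.
Qed.

(** The two exponentials occur only through their product, which is 1, and the term with factor c is
    symmetric in [v] and [w]. What remains is the real part of dc /\ (dt1 - i dt2). *)
Lemma omega_dTpar (p v w : C * C) : omega_can (dTpar p v) (dTpar p w) =
  fst (fst v) * fst (snd w) + snd (fst v) * snd (snd w) -
  (fst (fst w) * fst (snd v) + snd (fst w) * snd (snd v)).
Proof.
unfold omega_can, dTpar; cbn [fst snd].
assert (E := cexp_cancel (fst (snd p)) (snd (snd p))).
set (e := cexp (_, - _)) in *; set (e' := cexp (- _, _)) in *.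
set (dv := (_, - snd (snd v)) : C); set (dw := (_, - snd (snd w)) : C).
transitivity (fst (Cmult (Cmult e e') (Cminus (Cmult (fst v) dw)
  (Cmult (fst w) dv)))).
  apply (f_equal (fst : C -> R)); ring.
rewrite E; unfold dv, dw; destruct v as [[a b] [x y]], w as [[a' b'] [x' y']].
simpl; ring.
Qed.

Section Action_angle.

Variables (S : R2 -> R) (U : C -> Prop) (arg : C -> R).
Hypothesis S_smooth : smooth_on (fun _ => True) S.
Hypothesis U_open : open (T := C_UniformSpace) U.
Hypothesis U_nonzero : forall c, U c -> c <> RtoC 0.
Hypothesis U_gap : forall c, U c -> S1 S c - ln (Cmod c) <> 0.
Hypothesis arg_U : arg_branch U arg.

Notation tau1 := (fun c : R2 => S1 S c - ln (Cmod c)).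
Notation tau2 := (fun c : R2 => S2 S c + arg c).

Lemma Ck_on_tau1 (n : nat) : Ck_on (V := R2) n U tau1.
Proof. exact (Ck_on_sub _ _ _ _ U_nonzero (Ck_on_period_1 S S_smooth n)). Qed.

Lemma Ck_on_tau2 (n : nat) : Ck_on (V := R2) n U tau2.
Proof.
apply Ck_on_plus; [|apply Ck_on_arg; assumption].
apply (Ck_on_sub n (fun _ => True)); [auto | apply Ck_on_S2, S_smooth].
Qed.

Lemma Ck_on_z_m (n : nat) : Ck_on (V := R2) n U (z_m S arg).
Proof.
apply Ck_on_mult; [apply Ck_on_const|].
apply Ck_on_plus; [apply Ck_on_plus; [apply Ck_on_plus; apply Ck_on_mult|]|].
- apply Ck_on_opp; exact (Ck_on_sub _ _ _ _ U_nonzero (Ck_on_ln_Cmod n)).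
- apply Ck_on_R2_fst.
- apply Ck_on_arg; assumption.
- apply Ck_on_R2_snd.
- apply Ck_on_R2_fst.
- apply (Ck_on_sub n (fun _ => True)); [auto | exact (S_smooth n)].
Qed.

Lemma diff_z_m (c : R2) : U c -> filterdiff (z_m S arg : R2 -> R) (locally c)
  (fun v : R2 => / (2 * PI) * (tau1 c * fst v + tau2 c * snd v)).
Proof.
intros Hc; assert (P := sqnorm_pos c (U_nonzero c Hc)).
assert (L := diff_ln_Cmod c (U_nonzero c Hc)).
assert (A := diff_arg U arg U_open U_nonzero arg_U c Hc).
assert (X := diff_R2_fst c); assert (Y := diff_R2_snd c).
assert (M := diff_mult _ _ _ _ _ (diff_const (/ (2 * PI)) c) (diff_plus _ _ _ _ _
  (diff_plus _ _ _ _ _ (diff_plus _ _ _ _ _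
    (diff_mult _ _ _ _ _ (diff_opp _ _ _ L) X)
    (diff_mult _ _ _ _ _ A Y)) X) (diff_S S S_smooth c))).
apply (diff_ext_lin _ _ _ _ M); intros v; unfold sqnorm in *.
unfold_sorts.
generalize PI_RGT_0; intros Q; field; split; lra.
Qed.

(* Both sides are 2 pi times the mixed second derivative of z_m. *)
Lemma tau_closed (c : R2) : U c -> grad tau1 c (0, 1) = grad tau2 c (1, 0).
Proof.
intros Hc; assert (P := PI_RGT_0).
assert (D1 := grad_filterdiff _ 1 _ c (Ck_on_tau1 2) Hc).
assert (D2 := grad_filterdiff _ 1 _ c (Ck_on_tau2 2) Hc).
assert (H := second_derivative_sym U (z_m S arg)
  (fun c v => / (2 * PI) * (tau1 c * fst v + tau2 c * snd v))
  (0, 1) (1, 0) c U_open diff_z_m); cbv beta in H.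
assert (K : forall a b : R,
  Ck_on (V := R2) 1 U (fun c => / (2 * PI) * (tau1 c * a + tau2 c * b))).
  intros a b; apply Ck_on_mult; [apply Ck_on_const|].
  apply Ck_on_plus; apply Ck_on_mult; try apply Ck_on_const.
    exact (Ck_on_tau1 1).
  exact (Ck_on_tau2 1).
specialize (H (K _ _) (K _ _) Hc).
assert (E : forall (a b : R) (v : R2),
  Derive (fun s => / (2 * PI) * (tau1 (plus c (scal s v)) * a +
    tau2 (plus c (scal s v)) * b)) 0 =
  / (2 * PI) * (grad tau1 c v * a + grad tau2 c v * b)).
  intros a b v.
  refine (eq_trans (grad_eq _ _ _ (diff_mult _ _ _ _ _
    (diff_const (/ (2 * PI)) c) (diff_plus _ _ _ _ _
      (diff_mult _ _ _ _ _ D1 (diff_const a c))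
      (diff_mult _ _ _ _ _ D2 (diff_const b c)))) v) _).
  cbv beta; ring.
assert (H' := eq_trans (eq_trans (eq_sym (E _ _ _)) H) (E _ _ _)).
cbn [fst snd] in H'.
rewrite !Rmult_0_r, !Rmult_1_r, Rplus_0_r, Rplus_0_l in H'.
apply (Rmult_eq_reg_l (/ (2 * PI))); [exact H'|].
apply Rinv_neq_0_compat; lra.
Qed.

(** The definition matches on the pair; the form with projections is the one to which the
    differentiation rules apply. *)
Lemma theta_e_eq : theta_e S =
  (fun p => 2 * PI * fst (snd p) / (S1 S (fst p) - ln (Cmod (fst p)))).
Proof. apply functional_extensionality; intros [c t]; reflexivity. Qed.

Lemma theta_m_eq : theta_m S arg = (fun p => snd (snd p) -
  (S2 S (fst p) + arg (fst p)) / (S1 S (fst p) - ln (Cmod (fst p))) *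
  fst (snd p)).
Proof. apply functional_extensionality; intros [c t]; reflexivity. Qed.

Lemma Ck_on_theta_e (n : nat) :
  Ck_on (V := R4) n (fun p => U (fst p)) (theta_e S).
Proof.
rewrite theta_e_eq.
destruct (Ck_on_R4_coords n (fun p => U (fst p))) as [_ [T1 T2]].
exact (Ck_on_div n _ _ _ (fun p Hp => U_gap _ Hp)
  (Ck_on_mult n _ _ _ (Ck_on_const n _ (2 * PI)) T1)
  (Ck_on_comp_fst n U _ (Ck_on_tau1 n))).
Qed.

Lemma Ck_on_theta_m (n : nat) :
  Ck_on (V := R4) n (fun p => U (fst p)) (theta_m S arg).
Proof.
rewrite theta_m_eq.
destruct (Ck_on_R4_coords n (fun p => U (fst p))) as [_ [T1 T2]].
exact (Ck_on_minus n _ _ _ T2 (Ck_on_mult n _ _ _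
  (Ck_on_div n _ _ _ (fun p Hp => U_gap _ Hp)
    (Ck_on_comp_fst n U _ (Ck_on_tau2 n)) (Ck_on_comp_fst n U _ (Ck_on_tau1 n)))
  T1)).
Qed.

Lemma diff_theta_e (p : R4) : U (fst p) ->
  filterdiff (theta_e S : R4 -> R) (locally p) (fun v : R4 =>
    (2 * PI * fst (snd v) * tau1 (fst p) -
     2 * PI * fst (snd p) * grad tau1 (fst p) (fst v)) /
    (tau1 (fst p) * tau1 (fst p))).
Proof.
intros Hp; rewrite theta_e_eq.
assert (T1 := diff_comp_snd _ p _ (diff_R2_fst (snd p))).
assert (D1 := diff_comp_fst _ p _
  (grad_filterdiff _ 0 _ (fst p) (Ck_on_tau1 1) Hp)).
assert (M := diff_div (fun q : R4 => 2 * PI * fst (snd q))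
  (fun q : R4 => tau1 (fst q)) p _ _ (U_gap _ Hp)
  (diff_mult _ _ _ _ _ (diff_const (2 * PI) p) T1) D1).
apply (diff_ext_lin _ _ _ _ M); intros v.
f_equal; f_equal; f_equal; apply Rplus_eq_reg_l with 0; ring.
Qed.

Lemma diff_theta_m (p : R4) : U (fst p) ->
  filterdiff (theta_m S arg : R4 -> R) (locally p) (fun v : R4 =>
    snd (snd v) -
    ((grad tau2 (fst p) (fst v) * tau1 (fst p) -
      tau2 (fst p) * grad tau1 (fst p) (fst v)) /
     (tau1 (fst p) * tau1 (fst p)) * fst (snd p) +
     tau2 (fst p) / tau1 (fst p) * fst (snd v))).
Proof.
intros Hp; rewrite theta_m_eq.
assert (T1 := diff_comp_snd _ p _ (diff_R2_fst (snd p))).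
assert (T2 := diff_comp_snd _ p _ (diff_R2_snd (snd p))).
assert (D1 := diff_comp_fst _ p _
  (grad_filterdiff _ 0 _ (fst p) (Ck_on_tau1 1) Hp)).
assert (D2 := diff_comp_fst _ p _
  (grad_filterdiff _ 0 _ (fst p) (Ck_on_tau2 1) Hp)).
exact (diff_minus _ _ _ _ _ T2
  (diff_mult _ _ _ _ _ (diff_div (fun q : R4 => tau2 (fst q))
    (fun q : R4 => tau1 (fst q)) p _ _ (U_gap _ Hp) D2 D1) T1)).
Qed.

Lemma darboux (p : R4) : U (fst p) ->
  exists (dT : R4 -> R4) (dzm dze dthm dthe : R4 -> R),
    filterdiff (Tpar : R4 -> R4) (locally p) dT /\
    filterdiff (fun x : R4 => z_m S arg (fst x)) (locally p) dzm /\
    filterdiff (fun x : R4 => z_e (fst x)) (locally p) dze /\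
    filterdiff (theta_m S arg : R4 -> R) (locally p) dthm /\
    filterdiff (theta_e S : R4 -> R) (locally p) dthe /\
    forall v w : R4,
      omega_can (dT v) (dT w) = wedge dzm dthe v w + wedge dze dthm v w.
Proof.
intros Hp; do 5 eexists.
split; [apply diff_Tpar|].
split; [exact (diff_comp_fst _ p _ (diff_z_m _ Hp))|].
split; [exact (diff_comp_fst _ p _ (diff_R2_snd _))|].
split; [exact (diff_theta_m p Hp)|].
split; [exact (diff_theta_e p Hp)|].
intros v w; rewrite omega_dTpar; unfold wedge.
assert (L1 := R2_linear_eq _ (proj1 (grad_filterdiff _ 0 _ _ (Ck_on_tau1 1) Hp))).
assert (L2 := R2_linear_eq _ (proj1 (grad_filterdiff _ 0 _ _ (Ck_on_tau2 1) Hp))).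
assert (E := tau_closed _ Hp); assert (G := U_gap _ Hp); assert (P := PI_RGT_0).
cbv beta in *.
(* The dc2 /\ dt1 terms with coefficient tau2 / tau1 cancel between the two wedges. The terms with
   factor t1 add up to - (t1 / tau1) (d_2 tau1 - d_1 tau2) dc1 /\ dc2, which [tau_closed]
   removes. *)
rewrite (L1 (fst v)), (L1 (fst w)), (L2 (fst v)), (L2 (fst w)), E.
destruct v as [[v1 v2] [v3 v4]], w as [[w1 w2] [w3 w4]]; cbn [fst snd].
field; split; lra.
Qed.

End Action_angle.

(** * The period lattice *)

Lemma cexp_ln (r t : R) : 0 < r -> cexp (ln r, t) = Cmult (RtoC r) (cexp (0, t)).
Proof.
intros H; unfold cexp, Cmult, RtoC; simpl; rewrite exp_ln, exp_0 by exact H.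
f_equal; ring.
Qed.

Lemma polar (z : C) : z <> RtoC 0 -> exists t, z = cexp (ln (Cmod z), t).
Proof.
intros H; assert (P := proj1 (Cmod_gt_0 z) H).
assert (P' : RtoC (Cmod z) <> RtoC 0) by (intros E; inversion E; lra).
destruct (polar_unit (Cmult (RtoC (/ Cmod z)) z)) as [t Ht].
  rewrite Cmod_mult, Cmod_R, Rabs_pos_eq by (left; apply Rinv_0_lt_compat, P).
  apply Rinv_l; lra.
exists t; rewrite cexp_ln, <- Ht, RtoC_inv by (exact P || lra).
field; exact P'.
Qed.

Lemma cexp_eq (s t s' t' : R) : cexp (s, t) = cexp (s', t') <->
  s = s' /\ eq_mod_2pi t t'.
Proof.
split.
- intros E.
  assert (Es : s = s').
    apply exp_inv; change (exp (fst (s, t)) = exp (fst (s', t'))).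
    rewrite <- !Cmod_cexp, E; reflexivity.
  split; [exact Es|]; subst s'.
  unfold cexp in E; injection E; simpl; intros Hs Hc.
  assert (P := exp_pos s).
  apply Rmult_eq_reg_l in Hs; [|lra]; apply Rmult_eq_reg_l in Hc; [|lra].
  (* Passing to the half angle turns cos (t - t') = 1 into sin ((t - t') / 2) = 0, and the zeros of
     the sine are the multiples of pi. *)
  assert (H1 : cos (2 * ((t - t') / 2)) = 1).
    replace (2 * _) with (t - t') by field; rewrite cos_minus, Hs, Hc.
    generalize (sin2_cos2 t'); unfold Rsqr; lra.
  rewrite cos_2a_sin in H1.
  destruct (sin_eq_0_0 ((t - t') / 2)) as [k Hk]; [nra|].
  exists k; lra.
- intros [-> [k Hk]].
  replace t with (t' + 2 * IZR k * PI) by lra.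
  unfold cexp; simpl.
  enough (E : cos (t' + 2 * IZR k * PI) = cos t' /\
              sin (t' + 2 * IZR k * PI) = sin t').
    destruct E as [-> ->]; reflexivity.
  destruct (Z_le_gt_dec 0 k) as [L | L].
    rewrite <- (Z2Nat.id k L), <- INR_IZR_INZ; split; [apply cos_period|].
    apply sin_period.
  (* [cos_period] and [sin_period] count a natural number of turns, so a negative number of turns is
     unwound from the other end [x]. *)
  assert (Ek : IZR k = - INR (Z.to_nat (- k))).
    rewrite INR_IZR_INZ, Z2Nat.id, opp_IZR by lia; ring.
  set (x := t' + _).
  replace t' with (x + 2 * INR (Z.to_nat (- k)) * PI)
    by (unfold x; rewrite Ek; ring).
  rewrite cos_period, sin_period; split; reflexivity.
Qed.

(** The component [cexp (t1, - t2)] alone determines [t] up to the period of [phi2]; this is the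
    situation before gluing. *)
Lemma Tpar_inj (c : C) (t t' : R * R) : Tpar (c, t) = Tpar (c, t') <->
  fst t = fst t' /\ eq_mod_2pi (snd t) (snd t').
Proof.
rewrite !Tpar_eq; cbn [fst snd].
assert (N : forall x y, eq_mod_2pi (- x) (- y) -> eq_mod_2pi x y).
  intros x y [k Hk]; exists (- k)%Z; rewrite opp_IZR; lra.
split.
- intros E; assert (E2 := f_equal snd E); cbn [snd] in E2.
  apply cexp_eq in E2; destruct E2; auto.
- intros [E1 E2]; f_equal; [f_equal|]; apply cexp_eq.
  + split; [lra | exact E2].
  + split; [exact E1 | apply N; rewrite !Ropp_involutive; exact E2].
Qed.

Lemma Tpar_surj (z : C * C) :
  pi_can z <> RtoC 0 -> exists t, z = Tpar (pi_can z, t).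
Proof.
intros H; destruct (polar _ (snd_neq0 z H)) as [s Hs].
exists (ln (Cmod (snd z)), - s); apply eq_of_snd; [exact H | |].
- rewrite pi_can_Tpar; reflexivity.
- rewrite Tpar_eq; cbn [fst snd]; rewrite Ropp_involutive; exact Hs.
Qed.

Section Gluing.

Variables (eps : R) (S : R2 -> R) (U : C -> Prop) (arg : C -> R).
Hypothesis S_smooth : smooth_on (fun _ => True) S.
Hypothesis U_open : open (T := C_UniformSpace) U.
Hypothesis U_B0 : forall c, U c -> B0 eps c.
Hypothesis U_gap : forall c, U c -> S1 S c - ln (Cmod c) <> 0.
Hypothesis arg_U : arg_branch U arg.

(** With c = exp (ln|c| + i arg c), the factor c exp (- S_1 + i S_2) by which [psi] multiplies z_2
    becomes exp (- tau1 + i tau2). The first component follows from [eq_of_snd], since [psi]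
    preserves [pi_can]. *)
Lemma psi_Tpar (c : C) (t : R * R) : U c -> psi S (Tpar (c, t)) =
  Tpar (c, (fst t - fst (period_m S arg c), snd t - snd (period_m S arg c))).
Proof.
intros Hc; assert (H := proj2 (U_B0 c Hc)).
assert (E : pi_can (Tpar (c, t)) = c) by apply pi_can_Tpar.
assert (Hs := snd_neq0 (Tpar (c, t))); rewrite E in Hs.
assert (Ep := pi_can_psi S _ (Hs H)); rewrite E in Ep.
apply eq_of_snd.
- rewrite Ep; exact H.
- rewrite Ep; symmetry; apply pi_can_Tpar.
- rewrite snd_psi, E, !Tpar_eq; cbn [fst snd period_m].
  assert (Ec : c = cexp (ln (Cmod c), arg c)).
    rewrite cexp_ln by (apply Cmod_gt_0, H); apply arg_U, Hc.
  (* The third occurrence is the factor [c] of [snd_psi]; the first two are arguments of [S1] and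
     [S2] and must stay. *)
  rewrite Ec at 3; rewrite <- !cexp_plus; f_equal.
  apply injective_projections; simpl; ring.
Qed.

Lemma iter_psi_Tpar (n : nat) (c : C) (t : R * R) : U c ->
  Nat.iter n (psi S) (Tpar (c, t)) =
  Tpar (c, (fst t - INR n * fst (period_m S arg c),
            snd t - INR n * snd (period_m S arg c))).
Proof.
intros Hc; induction n as [|n IH].
- simpl Nat.iter; f_equal; f_equal; apply injective_projections; simpl; ring.
- rewrite Nat.iter_succ, IH, psi_Tpar, S_INR by exact Hc.
  f_equal; f_equal; apply injective_projections; cbn [fst snd]; ring.
Qed.

(** Of two glued points one is an iterate of the other under [psi] ([glued_iter]). The number of
    iterations gives the coefficient of [period_m], its sign telling which point is iterated, and
    [Tpar_inj] gives the coefficient of [period_e]. *)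
Lemma glued_Tpar (c : C) (t t' : R * R) : U c ->
  glued eps S (Tpar (c, t)) (Tpar (c, t')) <->
  period_lattice S arg c (fst t - fst t', snd t - snd t').
Proof.
intros Hc; assert (H := U_B0 c Hc).
assert (forward : forall n t t',
    Tpar (c, t') = Nat.iter n (psi S) (Tpar (c, t)) ->
    exists k : Z, fst t - fst t' = INR n * fst (period_m S arg c) /\
      snd t - snd t' = INR n * snd (period_m S arg c) + 2 * PI * IZR k).
  intros n u u' E; rewrite iter_psi_Tpar in E by exact Hc.
  apply Tpar_inj in E; cbn [fst snd] in E; destruct E as [E1 [k E2]].
  exists (- k)%Z; rewrite opp_IZR; lra.
assert (backward : forall n (k : Z) t t',
    fst t - fst t' = INR n * fst (period_m S arg c) ->
    snd t - snd t' = INR n * snd (period_m S arg c) + 2 * PI * IZR k ->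
    glued eps S (Tpar (c, t)) (Tpar (c, t'))).
  intros n k u u' E1 E2.
  replace (Tpar (c, u')) with (Nat.iter n (psi S) (Tpar (c, u))).
    apply glued_iter_psi; rewrite pi_can_Tpar; exact H.
  rewrite iter_psi_Tpar by exact Hc; apply Tpar_inj; cbn [fst snd].
  split; [lra | exists k; lra].
split.
- intros G; destruct (glued_iter _ _ _ _ G) as [n [E | E]].
  + rewrite pi_can_Tpar; exact (proj2 H).
  + destruct (forward n _ _ E) as [k [E1 E2]].
    exists (Z.of_nat n), k; rewrite <- INR_IZR_INZ; cbn [fst snd period_e].
    split; lra.
  + destruct (forward n _ _ E) as [k [E1 E2]].
    exists (- Z.of_nat n)%Z, (- k)%Z.
    rewrite !opp_IZR, <- INR_IZR_INZ; cbn [fst snd period_e]; split; lra.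
- intros [m [k [E1 E2]]]; cbn [fst snd period_e] in E1, E2.
  destruct (Z_le_gt_dec 0 m) as [L | L].
  + apply (backward (Z.to_nat m) k); rewrite INR_IZR_INZ, Z2Nat.id by exact L; lra.
  + apply rst_sym, (backward (Z.to_nat (- m)) (- k)%Z);
      rewrite INR_IZR_INZ, Z2Nat.id, !opp_IZR by lia; lra.
Qed.

(** The angles are 2 pi times the coordinates of t in the basis of periods: t = (theta_e / (2 pi))
    [period_m] + (theta_m / (2 pi)) [period_e]. Hence [theta_e] counts turns along gamma_m and
    [theta_m] turns along gamma_e. *)
Lemma period_lattice_angles (c : C) (t t' : R * R) : U c ->
  period_lattice S arg c (fst t - fst t', snd t - snd t') <->
  eq_mod_2pi (theta_m S arg (c, t)) (theta_m S arg (c, t')) /\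
  eq_mod_2pi (theta_e S (c, t)) (theta_e S (c, t')).
Proof.
intros Hc; assert (G := U_gap c Hc); assert (P := PI_RGT_0).
unfold period_lattice, eq_mod_2pi, theta_m, theta_e; cbn [fst snd period_m period_e].
set (a := S1 S c - ln (Cmod c)) in *; set (b := S2 S c + arg c).
split.
- intros [m [n [E1 E2]]]; split.
  + exists n; replace (snd t - b / a * fst t - (snd t' - b / a * fst t'))
      with (snd t - snd t' - b / a * (fst t - fst t')) by ring.
    rewrite E1, E2; field; exact G.
  + exists m; replace (2 * PI * fst t / a - 2 * PI * fst t' / a)
      with (2 * PI * (fst t - fst t') / a) by (field; exact G).
    rewrite E1; field; exact G.
- intros [[n En] [m Em]]; exists m, n.
  assert (E1 : fst t - fst t' = IZR m * a).
    replace (fst t - fst t') with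
      ((2 * PI * fst t / a - 2 * PI * fst t' / a) * a / (2 * PI)).
      rewrite Em; field; lra.
    field; split; lra.
  split; [rewrite E1; ring|].
  replace (snd t - snd t') with ((snd t - b / a * fst t -
    (snd t' - b / a * fst t')) + b / a * (fst t - fst t')) by ring.
  rewrite En, E1; field; exact G.
Qed.

(** Equal values of [z_e] put the two points on a horizontal segment, along which [z_m] has the
    nonzero derivative tau1 / (2 pi); the mean value theorem concludes. A square neighbourhood
    inside [U] contains all these segments. *)
Lemma z_local_inj (c0 : C) : U c0 -> exists V : C -> Prop,
  open (T := C_UniformSpace) V /\ V c0 /\ (forall c, V c -> U c) /\
  forall c c', V c -> V c' -> z_m S arg c = z_m S arg c' -> z_e c = z_e c' ->
  c = c'.
Proof.
intros H0; destruct (U_open c0 H0) as [e He]; destruct c0 as [x0 y0].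
pose (box := fun (a : R) (x : R) => a - e < x /\ x < a + e).
assert (box_open : forall a, open (box a)).
  intros a; apply open_and; [apply open_gt | apply open_lt].
exists (fun c => box x0 (fst c) /\ box y0 (snd c)).
assert (inU : forall c : C, box x0 (fst c) /\ box y0 (snd c) -> U c).
  intros [x y] [[X1 X2] [Y1 Y2]]; apply He; simpl in *; split; simpl;
    apply Rabs_def1; unfold minus, plus, opp; simpl; lra.
split; [|split; [|split; [exact inU|]]].
- apply (open_and (T := R2)).
  + apply (open_comp (T := R2) (fst : R2 -> R) (box x0)); [|apply box_open].
    intros c _; exact (linear_cont (fst : R2 -> R) c is_linear_R2_fst).
  + apply (open_comp (T := R2) (snd : R2 -> R) (box y0)); [|apply box_open].
    intros c _; exact (linear_cont (snd : R2 -> R) c is_linear_R2_snd).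
- destruct e as [e Pe]; unfold box; simpl; lra.
- intros [x y] [x' y'] [X Y] [X' _] Em Ee; unfold z_e in Ee; cbn [fst snd] in *.
  subst y'.
  assert (seg : forall s, Rmin x x' <= s <= Rmax x x' -> U (s, y)).
    intros s Hs; apply inU; split; [|exact Y]; unfold box in *; simpl.
    unfold Rmin, Rmax in Hs; destruct (Rle_dec x x'); lra.
  assert (der : forall s, U (s, y) -> is_derive (fun s => z_m S arg (s, y)) s
      (/ (2 * PI) * (S1 S (s, y) - ln (Cmod (s, y))))).
    intros s Us.
    assert (D := diff_slice_1 _ s y _ (diff_z_m S U arg S_smooth U_open
      (fun c Hc => proj2 (U_B0 c Hc)) arg_U (s, y) Us)).
    cbn [fst snd] in D; rewrite Rmult_1_r, Rmult_0_r, Rplus_0_r in D; exact D.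
  destruct (MVT_gen (fun s => z_m S arg (s, y)) x x'
    (fun s => / (2 * PI) * (S1 S (s, y) - ln (Cmod (s, y))))) as [s [Hs E]].
  + intros s Hs; apply der, seg; lra.
  + intros s Hs; apply continuity_pt_filterlim.
    exact (ex_derive_continuous _ _ (ex_intro _ _ (der s (seg s Hs)))).
  + assert (Us := seg s Hs).
    rewrite Em, Rminus_diag in E.
    assert (G := U_gap _ Us); assert (P := PI_RGT_0).
    symmetry in E; apply Rmult_integral in E; destruct E as [E | E].
      exfalso; apply Rmult_integral in E; destruct E as [E | E]; [|exact (G E)].
      revert E; apply Rinv_neq_0_compat; lra.
    f_equal; lra.
Qed.

Lemma local_coordinates (c0 : C) : U c0 -> exists V : C -> Prop,
  open (T := C_UniformSpace) V /\ V c0 /\ (forall c, V c -> U c) /\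
  forall p q : C * C, V (fst p) -> V (fst q) ->
    (glued eps S (Tpar p) (Tpar q) <->
     z_m S arg (fst p) = z_m S arg (fst q) /\
     z_e (fst p) = z_e (fst q) /\
     eq_mod_2pi (theta_m S arg p) (theta_m S arg q) /\
     eq_mod_2pi (theta_e S p) (theta_e S q)).
Proof.
intros H0; destruct (z_local_inj c0 H0) as [V [VO [V0 [VU inj]]]].
exists V; split; [exact VO | split; [exact V0 | split; [exact VU|]]].
intros [c t] [c' t'] Vc Vc'; cbn [fst snd] in *; split.
- intros G; assert (E := glued_pi_can _ _ _ _ G).
  rewrite !pi_can_Tpar in E; cbn [fst] in E; subst c'.
  split; [reflexivity | split; [reflexivity|]].
  apply period_lattice_angles, glued_Tpar, G; exact (VU c Vc).
- intros [Em [Ee Ea]]; assert (E := inj c c' Vc Vc' Em Ee); subst c'.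
  apply glued_Tpar, period_lattice_angles, Ea; exact (VU c Vc).
Qed.

Lemma period_lattice_standard (c : C) : U c -> forall a b : R,
  (exists t, period_lattice S arg c t /\
     theta_m S arg (c, t) = a /\ theta_e S (c, t) = b) <->
  (exists m n : Z, a = 2 * PI * IZR m /\ b = 2 * PI * IZR n).
Proof.
intros Hc a b; assert (G := U_gap c Hc).
unfold period_lattice, theta_m, theta_e; cbn [fst snd period_m period_e].
set (x := S1 S c - ln (Cmod c)) in *; set (y := S2 S c + arg c).
split.
(* The integers are exchanged: the coefficient of [period_m] is read off by [theta_e], that of
   [period_e] by [theta_m]. *)
- intros [t [[m [n [E1 E2]]] [<- <-]]]; exists n, m; rewrite E1, E2.
  split; field; exact G.
- intros [n [m [-> ->]]].
  exists (IZR m * x, IZR m * y + IZR n * (2 * PI)); cbn [fst snd]; split.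
    exists m, n; split; ring.
  split; field; exact G.
Qed.

End Gluing.

(** * An invariant primitive of the symplectic form *)

Definition dpi_can (z v : C * C) : C :=
  Cplus (Cmult (fst v) (snd z)) (Cmult (fst z) (snd v)).

Lemma diff_pi_can (z : R4) :
  filterdiff (pi_can : R4 -> R2) (locally z) (dpi_can z).
Proof.
apply (diff_C_mult (V := R4) fst snd z fst snd); apply filterdiff_linear.
  apply is_linear_R4_fst.
apply is_linear_R4_snd.
Qed.

Lemma diff_comp_pi_can (f : R2 -> R) (z : R4) (df : R2 -> R) :
  filterdiff f (locally (pi_can z : R2)) df ->
  filterdiff (fun z : R4 => f (pi_can z)) (locally z)
    (fun v => df (dpi_can z v)).
Proof.
exact (filterdiff_comp' (pi_can : R4 -> R2) f z _ df (diff_pi_can z)).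
Qed.

Lemma diff_unique_C {V : NormedModule R_AbsRing} (f : V -> R2) (z : V)
  (df dg : V -> R2) :
  filterdiff f (locally z) df -> filterdiff f (locally z) dg ->
  forall v, df v = dg v.
Proof.
intros Hf Hg v; apply injective_projections.
- exact (diff_unique _ _ _ _ (diff_C_fst _ _ _ Hf) (diff_C_fst _ _ _ Hg) v).
- exact (diff_unique _ _ _ _ (diff_C_snd _ _ _ Hf) (diff_C_snd _ _ _ Hg) v).
Qed.

Lemma open_pi_can (U : C -> Prop) :
  open (T := C_UniformSpace) U -> open (T := R4) (fun z => U (pi_can z)).
Proof.
intros HU; apply (open_comp (T := R4) (U := R2) pi_can U); [|exact HU].
intros z _; apply (filterdiff_continuous (pi_can : R4 -> R2)).
exists (dpi_can z); apply diff_pi_can.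
Qed.

Lemma Ck_on_comp_pi_can (n : nat) (D : R2 -> Prop) (f : R2 -> R) :
  Ck_on n D f ->
  Ck_on (V := R4) n (fun z => D (pi_can z)) (fun z => f (pi_can z)).
Proof.
intros Hf.
destruct (Ck_on_R4_coords n (fun z => D (pi_can z))) as [[A B] [X Y]].
refine (Ck_on_comp_R2 n D _ f (fun z : R4 => fst (pi_can z))
  (fun z : R4 => snd (pi_can z)) Hf _ _ _).
- exact (Ck_on_minus _ _ _ _ (Ck_on_mult _ _ _ _ A X) (Ck_on_mult _ _ _ _ B Y)).
- exact (Ck_on_plus _ _ _ _ (Ck_on_mult _ _ _ _ A Y) (Ck_on_mult _ _ _ _ B X)).
- intros z Hz; exact Hz.
Qed.

Section Primitive.

Variables (S : R2 -> R) (U : C -> Prop).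
Hypothesis S_smooth : smooth_on (fun _ => True) S.
Hypothesis U_open : open (T := C_UniformSpace) U.
Hypothesis U_nonzero : forall c, U c -> c <> RtoC 0.
Hypothesis U_gap : forall c, U c -> S1 S c - ln (Cmod c) <> 0.

Notation UW := (fun z : R4 => U (pi_can z)).

(** The invariance clause of [primitive_over] speaks of an arbitrary differential of [psi], so
    existence is what gives it content. *)
Lemma diff_psi (z : R4) : UW z ->
  exists dpsi : R4 -> R4, filterdiff (psi S : R4 -> R4) (locally z) dpsi.
Proof.
intros Hz.
assert (H2 : snd z <> RtoC 0) by apply (snd_neq0 z (U_nonzero _ Hz)).
assert (D1 := diff_comp_pi_can _ z _
  (grad_filterdiff _ 0 _ (pi_can z) (Ck_on_S1 S S_smooth 1) I)).
assert (D2 := diff_comp_pi_can _ z _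
  (grad_filterdiff _ 0 _ (pi_can z) (Ck_on_S2 S S_smooth 1) I)).
assert (F := filterdiff_linear (F := locally z) _ is_linear_R4_fst).
assert (G := filterdiff_linear (F := locally z) _ is_linear_R4_snd).
eexists; apply (diff_pair (W1 := R2) (W2 := R2)).
- apply (diff_C_mult (V := R4)
    (fun z : R4 => cexp (S1 S (pi_can z), - S2 S (pi_can z)))
    (fun z : R4 => Cinv (snd z))).
  + exact (diff_C_exp _ _ _ (diff_pair _ _ _ _ _ D1 (diff_opp _ _ _ D2))).
  + exact (diff_C_inv _ _ _ H2 G).
- apply (diff_C_mult (V := R4)
    (fun z : R4 => cexp (- S1 S (pi_can z), S2 S (pi_can z)))
    (fun z : R4 => Cmult (fst z) (Cmult (snd z) (snd z)))).
  + exact (diff_C_exp _ _ _ (diff_pair _ _ _ _ _ (diff_opp _ _ _ D1) D2)).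
  + exact (diff_C_mult _ _ _ _ _ F (diff_C_mult _ _ _ _ _ G G)).
Qed.

Definition drift (c : C) : R :=
  fst c * S1 S c + snd c * S2 S c - fst c - S c.

(** On [Tpar (c, t)] the value of ln|z_2| is t1, so this is [drift] times theta_e / (2 pi), which
    varies by [drift] over one turn along gamma_m. *)
Definition potential (z : C * C) : R :=
  drift (pi_can z) / (S1 S (pi_can z) - ln (Cmod (pi_can z))) *
  ln (Cmod (snd z)).

(* Re (z_1 dz_2) is a primitive of omega_can, and psi changes it by the
   differential of [drift]; so does psi change [potential] by [drift]. *)
Definition primitive (z v : C * C) : R :=
  fst (Cmult (fst z) (snd v)) - grad (V := R4) potential z v.

Lemma Ck_on_drift (n : nat) : Ck_on (V := R2) n (fun _ => True) drift.
Proof.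
assert (A := Ck_on_R2_fst n (fun _ => True)).
assert (B := Ck_on_R2_snd n (fun _ => True)).
exact (Ck_on_minus _ _ _ _ (Ck_on_minus _ _ _ _ (Ck_on_plus _ _ _ _
  (Ck_on_mult _ _ _ _ A (Ck_on_S1 S S_smooth n))
  (Ck_on_mult _ _ _ _ B (Ck_on_S2 S S_smooth n))) A) (S_smooth n)).
Qed.

Lemma diff_drift (c : R2) : filterdiff (drift : R2 -> R) (locally c)
  (fun v : R2 => fst c * grad (V := R2) (S1 S) c v +
                 snd c * grad (V := R2) (S2 S) c v - fst v).
Proof.
assert (D1 := grad_filterdiff _ 0 _ c (Ck_on_S1 S S_smooth 1) I).
assert (D2 := grad_filterdiff _ 0 _ c (Ck_on_S2 S S_smooth 1) I).
assert (A := diff_R2_fst c); assert (B := diff_R2_snd c).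
apply (diff_ext_lin _ _ _ _ (diff_minus _ _ _ _ _ (diff_minus _ _ _ _ _
  (diff_plus _ _ _ _ _ (diff_mult _ _ _ _ _ A D1) (diff_mult _ _ _ _ _ B D2)) A)
  (diff_S S S_smooth c))).
intros v.
unfold_sorts.
ring.
Qed.

Lemma Ck_on_potential (n : nat) : Ck_on (V := R4) n UW potential.
Proof.
apply Ck_on_mult.
- apply (Ck_on_comp_pi_can n U
    (fun c => drift c / (S1 S c - ln (Cmod c)))).
  apply Ck_on_div; [exact U_gap | |].
    exact (Ck_on_sub n _ U _ (fun _ _ => I) (Ck_on_drift n)).
  exact (Ck_on_sub n _ U _ U_nonzero (Ck_on_period_1 S S_smooth n)).
- apply (Ck_on_sub n (fun z : R4 => snd z <> RtoC 0)).
    intros z Hz; exact (snd_neq0 z (U_nonzero _ Hz)).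
  exact (Ck_on_comp_snd n _ _ (Ck_on_ln_Cmod n)).
Qed.

Lemma diff_potential (z : R4) : UW z ->
  filterdiff (potential : R4 -> R) (locally z) (grad (V := R4) potential z).
Proof. exact (grad_filterdiff UW 0 _ z (Ck_on_potential 1)). Qed.

Lemma diff_liouville (w : R4) (z : R4) :
  filterdiff (fun z : R4 => fst (Cmult (fst z) (snd w))) (locally z)
    (fun v : R4 => fst (Cmult (fst v) (snd w))).
Proof.
apply (filterdiff_linear (fun z : R4 => fst (Cmult (fst z) (snd w)))).
apply (is_linear_comp (fst : R4 -> R2) (fun c : R2 => fst (Cmult c (snd w)))).
  apply is_linear_R4_fst.
assert (L := proj1 (diff_minus _ _ _ _ _
  (diff_mult _ _ _ _ _ (diff_R2_fst (0, 0)) (diff_const (fst (snd w)) _))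
  (diff_mult _ _ _ _ _ (diff_R2_snd (0, 0)) (diff_const (snd (snd w)) _)))).
apply (is_linear_ext (V := R_NormedModule) _ _) with (2 := L).
intros [x y]; simpl; change ((x * fst (snd w) + 0 * 0 -
  (y * snd (snd w) + 0 * 0)) = (x * fst (snd w) - y * snd (snd w))); ring.
Qed.

Lemma primitive_linear (z : R4) : UW z -> is_linear (primitive z : R4 -> R).
Proof.
intros Hz.
assert (X := diff_comp_snd _ z _ (diff_R2_fst (snd z))).
assert (Y := diff_comp_snd _ z _ (diff_R2_snd (snd z))).
(* Linearity is the first half of [filterdiff]: [primitive z] is, up to rewriting, the differential
   at [z] of a real function in which the coefficient z_1 is frozen. *)
assert (L := proj1 (diff_minus _ _ _ _ _ (diff_minus _ _ _ _ _
  (diff_mult _ _ _ _ _ (diff_const (fst (fst z)) z) X)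
  (diff_mult _ _ _ _ _ (diff_const (snd (fst z)) z) Y))
  (diff_potential z Hz))).
apply (is_linear_ext (V := R_NormedModule) _ _) with (2 := L).
intros [v1 [x y]]; unfold primitive, Cmult; cbn [fst snd].
unfold_sorts; ring.
Qed.

Lemma primitive_smooth (v : R4) :
  smooth_on UW (fun z : R4 => primitive z v).
Proof.
intros n; destruct (Ck_on_R4_coords n UW) as [[A B] _].
exact (Ck_on_minus n UW _ _ (Ck_on_minus n UW _ _
  (Ck_on_mult n UW _ _ A (Ck_on_const n UW (fst (snd v))))
  (Ck_on_mult n UW _ _ B (Ck_on_const n UW (snd (snd v)))))
  (grad_Ck UW n potential v (open_pi_can U U_open)
    (Ck_on_potential (Datatypes.S n)))).
Qed.

Lemma primitive_invariant (z : R4) (dpsi : R4 -> R4) : UW z ->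
  filterdiff (psi S : R4 -> R4) (locally z) dpsi ->
  forall v, primitive (psi S z) (dpsi v) = primitive z v.
Proof.
intros Hz Hpsi v.
assert (Hc := U_nonzero _ Hz); assert (H2 := snd_neq0 z Hc).
assert (Ep := pi_can_psi S z H2).
assert (Hz' : UW (psi S z)) by (rewrite Ep; exact Hz).
(* Both sides are differentials at [z] of [potential] composed with [psi], which equals [potential]
   minus [drift] near [z]; uniqueness of the differential avoids any formula for [dpsi]. *)
assert (E1 : forall v, grad (V := R4) potential (psi S z) (dpsi v) =
    grad (V := R4) potential z v -
    (fst (pi_can z) * grad (V := R2) (S1 S) (pi_can z) (dpi_can z v) +
     snd (pi_can z) * grad (V := R2) (S2 S) (pi_can z) (dpi_can z v) -
     fst (dpi_can z v))).
  apply (diff_unique (fun z : R4 => potential (psi S z)) z).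
    apply (filterdiff_comp' (psi S : R4 -> R4) (potential : R4 -> R) z dpsi).
      exact Hpsi.
    exact (diff_potential _ Hz').
  apply (filterdiff_ext_locally
    (fun z : R4 => potential z - drift (pi_can z))).
    generalize (open_pi_can U U_open z Hz); apply filter_imp.
    intros x Hx; assert (Hcx := U_nonzero _ Hx); unfold potential.
    rewrite ln_snd_psi, pi_can_psi by (exact Hcx || exact (snd_neq0 x Hcx)).
    unfold_sorts; field; exact (U_gap _ Hx).
  exact (diff_minus _ _ _ _ _ (diff_potential z Hz)
    (diff_comp_pi_can _ z _ (diff_drift (pi_can z)))).
pose (M := cexp (- S1 S (pi_can z), S2 S (pi_can z))).
pose (s := (- grad (V := R2) (S1 S) (pi_can z) (dpi_can z v),
            grad (V := R2) (S2 S) (pi_can z) (dpi_can z v)) : C).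
(* Only the second component of [dpsi] enters z_1 dz_2. It is obtained from [snd_psi] by the same
   uniqueness, with [s] standing for - dS_1 + i dS_2. *)
assert (E2 : snd (dpsi v) = Cplus (Cmult (Cmult M s) (Cmult (pi_can z) (snd z)))
    (Cmult M (Cplus (Cmult (dpi_can z v) (snd z)) (Cmult (pi_can z) (snd v))))).
  assert (D1 := diff_comp_pi_can _ z _
    (grad_filterdiff _ 0 _ (pi_can z) (Ck_on_S1 S S_smooth 1) I)).
  assert (D2 := diff_comp_pi_can _ z _
    (grad_filterdiff _ 0 _ (pi_can z) (Ck_on_S2 S S_smooth 1) I)).
  assert (F := filterdiff_linear (F := locally z) _ is_linear_R4_snd).
  refine (diff_unique_C (fun z : R4 => snd (psi S z)) z (fun v => snd (dpsi v))
    _ _ (filterdiff_ext (V := R2) _ _ _ (fun x => eq_sym (snd_psi S x))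
    (diff_C_mult _ _ _ _ _
      (diff_C_exp _ _ _ (diff_pair _ _ _ _ _ (diff_opp _ _ _ D1) D2))
      (diff_C_mult _ _ _ _ _ (diff_pi_can z) F))) v).
  apply (filterdiff_comp' (psi S : R4 -> R4) (snd : R4 -> R2) z dpsi snd Hpsi).
  apply filterdiff_linear, is_linear_R4_snd.
assert (E3 : Cmult (fst (psi S z)) (snd (dpsi v)) =
    Cplus (Cmult s (pi_can z)) (Cplus (dpi_can z v) (Cmult (fst z) (snd v)))).
  rewrite E2; unfold psi; cbv zeta; cbn [fst].
  transitivity (Cmult (Cmult (cexp (S1 S (pi_can z), - S2 S (pi_can z))) M)
    (Cplus (Cmult s (pi_can z)) (Cplus (dpi_can z v) (Cmult (fst z) (snd v))))).
    unfold_sorts; rewrite (fst_snd z Hc); field; exact H2.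
  unfold M; rewrite cexp_cancel; ring.
unfold primitive; rewrite E1; unfold_sorts; rewrite E3; unfold s; simpl; ring.
Qed.

(** The Liouville part contributes [omega_can], and the part [grad potential] is closed because
    second derivatives are symmetric. *)
Lemma primitive_ext_d (z v w : R4) : UW z ->
  ext_d primitive z v w = omega_can v w.
Proof.
intros Hz.
assert (HD := open_pi_can U U_open).
assert (E : forall v w : R4, grad (V := R4) (fun z => primitive z w) z v =
    fst (Cmult (fst v) (snd w)) -
    grad (V := R4) (fun z => grad (V := R4) potential z w) z v).
  intros v' w'.
  apply (grad_eq (V := R4) (fun z => primitive z w') z (fun v : R4 =>
    fst (Cmult (fst v) (snd w')) -
    grad (V := R4) (fun z => grad (V := R4) potential z w') z v)).
  apply diff_minus; [apply diff_liouville|].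
  apply (grad_filterdiff UW 0); [|exact Hz].
  exact (grad_Ck UW 1 potential w' HD (Ck_on_potential 2)).
change (grad (V := R4) (fun z => primitive z w) z v -
  grad (V := R4) (fun z => primitive z v) z w = omega_can v w).
rewrite !E, (grad_sym UW potential v w z HD (Ck_on_potential 2) Hz).
unfold omega_can; simpl; ring.
Qed.

Lemma primitive_exists : primitive_over S U primitive.
Proof.
split; [exact primitive_linear | split; [exact primitive_smooth | split]].
- exact primitive_invariant.
- exact primitive_ext_d.
Qed.

End Primitive.

(** * Integrals of 1-forms along homotopies *)

Lemma is_derive_R4 (z : R -> R4) (x : R) (z' : R4) : is_derive z x z' <->
  (is_derive (fun x => fst (fst (z x))) x (fst (fst z')) /\
   is_derive (fun x => snd (fst (z x))) x (snd (fst z'))) /\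
  (is_derive (fun x => fst (snd (z x))) x (fst (snd z')) /\
   is_derive (fun x => snd (snd (z x))) x (snd (snd z'))).
Proof.
split.
- intros H; split; split.
  + apply (is_derive_along (fun p : R4 => fst (fst p)) z x z'
      (fun p => fst (fst p))); [|exact H].
    exact (diff_comp_fst _ _ _ (diff_R2_fst _)).
  + apply (is_derive_along (fun p : R4 => snd (fst p)) z x z'
      (fun p => snd (fst p))); [|exact H].
    exact (diff_comp_fst _ _ _ (diff_R2_snd _)).
  + apply (is_derive_along (fun p : R4 => fst (snd p)) z x z'
      (fun p => fst (snd p))); [|exact H].
    exact (diff_comp_snd _ _ _ (diff_R2_fst _)).
  + apply (is_derive_along (fun p : R4 => snd (snd p)) z x z'
      (fun p => snd (snd p))); [|exact H].
    exact (diff_comp_snd _ _ _ (diff_R2_snd _)).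
- intros [[H1 H2] [H3 H4]].
  apply (filterdiff_ext (V := R4) (fun x =>
    ((fst (fst (z x)), snd (fst (z x))), (fst (snd (z x)), snd (snd (z x)))))).
    intros y; destruct (z y) as [[a b] [c d]]; reflexivity.
  apply (diff_pair (V := AbsRing_NormedModule R_AbsRing) (W1 := R2) (W2 := R2)).
  + exact (diff_pair (V := AbsRing_NormedModule R_AbsRing) _ _ _ _ _ H1 H2).
  + exact (diff_pair (V := AbsRing_NormedModule R_AbsRing) _ _ _ _ _ H3 H4).
Qed.

Lemma is_derive_R4_unique (z : R -> R4) (x : R) (l l' : R4) :
  is_derive z x l -> is_derive z x l' -> l = l'.
Proof.
intros H H'; apply is_derive_R4 in H; apply is_derive_R4 in H'.
destruct H as [[H1 H2] [H3 H4]], H' as [[H1' H2'] [H3' H4']].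
apply injective_projections; apply injective_projections;
  eapply eq_trans; [symmetry| |symmetry| |symmetry| |symmetry|];
  apply is_derive_unique; eassumption.
Qed.

Lemma continuous_R4 {T : UniformSpace} (z : T -> R4) (q : T) : continuous z q <->
  (continuous (fun x => fst (fst (z x))) q /\
   continuous (fun x => snd (fst (z x))) q) /\
  (continuous (fun x => fst (snd (z x))) q /\
   continuous (fun x => snd (snd (z x))) q).
Proof.
assert (lin : forall l : R4 -> R, is_linear l -> continuous z q ->
    continuous (fun x => l (z x)) q).
  intros l Hl Hz; apply (continuous_comp (V := R4) z l); [exact Hz|].
  exact (linear_cont l (z q) Hl).
split.
- intros H; split; split.
  + apply (lin (fun p => fst (fst p))); [|exact H].
    exact (is_linear_comp _ _ is_linear_R4_fst is_linear_R2_fst).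
  + apply (lin (fun p => snd (fst p))); [|exact H].
    exact (is_linear_comp _ _ is_linear_R4_fst is_linear_R2_snd).
  + apply (lin (fun p => fst (snd p))); [|exact H].
    exact (is_linear_comp _ _ is_linear_R4_snd is_linear_R2_fst).
  + apply (lin (fun p => snd (snd p))); [|exact H].
    exact (is_linear_comp _ _ is_linear_R4_snd is_linear_R2_snd).
- intros [[H1 H2] [H3 H4]].
  apply (continuous_ext (U := R4) (fun x =>
    ((fst (fst (z x)), snd (fst (z x))), (fst (snd (z x)), snd (snd (z x)))))).
    intros y; destruct (z y) as [[a b] [c d]]; reflexivity.
  exact (continuous_pair (A := R2) (B := R2) _ _ _ (continuous_pair _ _ _ H1 H2)
    (continuous_pair _ _ _ H3 H4)).
Qed.

Section Forms.

Variables (D : R4 -> Prop) (a : R4 -> R4 -> R).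
Hypothesis D_open : open D.
Hypothesis a_linear : forall p, D p -> is_linear (a p).

Lemma form_continuous {T : UniformSpace} (z v : T -> R4) (q : T) :
  (forall u, Ck_on 0 D (fun p => a p u)) -> D (z q) ->
  continuous z q -> continuous v q -> continuous (fun x => a (z x) (v x)) q.
Proof.
intros Ca Hq Hz Hv.
apply (continuous_ext_loc _ (fun x =>
  fst (fst (v x)) * a (z x) ((1, 0), (0, 0)) +
  snd (fst (v x)) * a (z x) ((0, 1), (0, 0)) +
  fst (snd (v x)) * a (z x) ((0, 0), (1, 0)) +
  snd (snd (v x)) * a (z x) ((0, 0), (0, 1)))).
  generalize (Hz D (D_open _ Hq) : locally q (fun x => D (z x))); apply filter_imp;
    intros x Hx; symmetry.
  exact (linear_R4 _ (a_linear _ Hx) (v x)).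
assert (K : forall u, continuous (fun x => a (z x) u) q).
  intros u; apply (continuous_comp (V := R4) z (fun p => a p u)); [exact Hz|].
  exact (Ca u (z q) Hq).
apply continuous_R4 in Hv; destruct Hv as [[V1 V2] [V3 V4]].
exact (continuous_plus _ _ _ (continuous_plus _ _ _ (continuous_plus _ _ _
  (continuous_mult _ _ _ V1 (K _)) (continuous_mult _ _ _ V2 (K _)))
  (continuous_mult _ _ _ V3 (K _))) (continuous_mult _ _ _ V4 (K _))).
Qed.

Hypothesis a_C1 : forall u, Ck_on 1 D (fun p => a p u).

Lemma form_diff (p u : R4) : D p ->
  filterdiff (fun p => a p u) (locally p) (grad (fun p => a p u) p).
Proof. intros Hp; exact (grad_filterdiff D 0 _ p (a_C1 u) Hp). Qed.

Lemma form_grad_coords (p u v : R4) : D p -> grad (fun p => a p u) p v =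
  fst (fst u) * grad (fun p => a p ((1, 0), (0, 0))) p v +
  snd (fst u) * grad (fun p => a p ((0, 1), (0, 0))) p v +
  fst (snd u) * grad (fun p => a p ((0, 0), (1, 0))) p v +
  snd (snd u) * grad (fun p => a p ((0, 0), (0, 1))) p v.
Proof.
intros Hp; apply (grad_eq (fun p => a p u) p (fun v : R4 =>
  fst (fst u) * grad (fun p => a p ((1, 0), (0, 0))) p v +
  snd (fst u) * grad (fun p => a p ((0, 1), (0, 0))) p v +
  fst (snd u) * grad (fun p => a p ((0, 0), (1, 0))) p v +
  snd (snd u) * grad (fun p => a p ((0, 0), (0, 1))) p v)).
apply (filterdiff_ext_locally (fun p : R4 => fst (fst u) * a p ((1, 0), (0, 0)) +
  snd (fst u) * a p ((0, 1), (0, 0)) + fst (snd u) * a p ((0, 0), (1, 0)) +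
  snd (snd u) * a p ((0, 0), (0, 1)))).
  generalize (D_open p Hp); apply filter_imp;
    intros x Hx; symmetry.
  exact (linear_R4 _ (a_linear _ Hx) u).
assert (K : forall (r : R) (w : R4), filterdiff (fun p => r * a p w) (locally p)
    (fun v => r * grad (fun p => a p w) p v)).
  intros r w; apply (diff_ext_lin _ _ _ _
    (diff_mult _ _ _ _ _ (diff_const r p) (form_diff p w Hp))).
  intros x; ring.
exact (diff_plus _ _ _ _ _ (diff_plus _ _ _ _ _ (diff_plus _ _ _ _ _
  (K _ _) (K _ _)) (K _ _)) (K _ _)).
Qed.

(** The expression is expanded twice, in [u] and then in [v], until only derivatives of [a] with
    both vectors fixed remain; these are continuous by [a_C1]. *)
Lemma form_grad_continuous {T : UniformSpace} (z u v : T -> R4) (q : T) :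
  D (z q) -> continuous z q -> continuous u q -> continuous v q ->
  continuous (fun x => grad (fun p => a p (u x)) (z x) (v x)) q.
Proof.
intros Hq Hz Hu Hv.
apply (continuous_ext_loc _ (fun x =>
  fst (fst (u x)) * grad (fun p => a p ((1, 0), (0, 0))) (z x) (v x) +
  snd (fst (u x)) * grad (fun p => a p ((0, 1), (0, 0))) (z x) (v x) +
  fst (snd (u x)) * grad (fun p => a p ((0, 0), (1, 0))) (z x) (v x) +
  snd (snd (u x)) * grad (fun p => a p ((0, 0), (0, 1))) (z x) (v x))).
  generalize (Hz D (D_open _ Hq) : locally q (fun x => D (z x))); apply filter_imp;
    intros x Hx; symmetry.
  exact (form_grad_coords (z x) (u x) (v x) Hx).
assert (K : forall w,
    continuous (fun x => grad (fun p => a p w) (z x) (v x)) q).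
  intros w.
  assert (lin : forall p, D p -> is_linear (grad (fun p => a p w) p)).
    intros p Hp; exact (proj1 (form_diff p w Hp)).
  clear - D_open a_C1 lin Hq Hz Hv.
  apply (continuous_ext_loc _ (fun x =>
    fst (fst (v x)) * grad (fun p => a p w) (z x) ((1, 0), (0, 0)) +
    snd (fst (v x)) * grad (fun p => a p w) (z x) ((0, 1), (0, 0)) +
    fst (snd (v x)) * grad (fun p => a p w) (z x) ((0, 0), (1, 0)) +
    snd (snd (v x)) * grad (fun p => a p w) (z x) ((0, 0), (0, 1)))).
    generalize (Hz D (D_open _ Hq) : locally q (fun x => D (z x))); apply filter_imp;
    intros x Hx; symmetry.
    exact (linear_R4 _ (lin _ Hx) (v x)).
  assert (L : forall e, continuous (fun x => grad (fun p => a p w) (z x) e) q).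
    intros e; apply (continuous_comp (V := R4) z (fun p => grad (fun p => a p w) p e));
      [exact Hz|].
    exact (grad_Ck D 0 _ e D_open (a_C1 w) (z q) Hq).
  apply continuous_R4 in Hv; destruct Hv as [[V1 V2] [V3 V4]].
  exact (continuous_plus _ _ _ (continuous_plus _ _ _ (continuous_plus _ _ _
    (continuous_mult _ _ _ V1 (L _)) (continuous_mult _ _ _ V2 (L _)))
    (continuous_mult _ _ _ V3 (L _))) (continuous_mult _ _ _ V4 (L _))).
apply continuous_R4 in Hu; destruct Hu as [[V1 V2] [V3 V4]].
exact (continuous_plus _ _ _ (continuous_plus _ _ _ (continuous_plus _ _ _
  (continuous_mult _ _ _ V1 (K _)) (continuous_mult _ _ _ V2 (K _)))
  (continuous_mult _ _ _ V3 (K _))) (continuous_mult _ _ _ V4 (K _))).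
Qed.

Lemma form_is_derive (z v : R -> R4) (x : R) (z' v' : R4) : D (z x) ->
  is_derive z x z' -> is_derive v x v' ->
  is_derive (fun x => a (z x) (v x)) x
    (grad (fun p => a p (v x)) (z x) z' + a (z x) v').
Proof.
intros Hx Hz Hv.
assert (Cz : continuous z x).
  exact (ex_derive_continuous z x (ex_intro _ _ Hz)).
apply (is_derive_ext_loc (fun x =>
  fst (fst (v x)) * a (z x) ((1, 0), (0, 0)) +
  snd (fst (v x)) * a (z x) ((0, 1), (0, 0)) +
  fst (snd (v x)) * a (z x) ((0, 0), (1, 0)) +
  snd (snd (v x)) * a (z x) ((0, 0), (0, 1)))).
  generalize (Cz D (D_open _ Hx) : locally x (fun x => D (z x))); apply filter_imp;
    intros y Hy; symmetry.
  exact (linear_R4 _ (a_linear _ Hy) (v y)).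
rewrite form_grad_coords, (linear_R4 _ (a_linear _ Hx) v') by exact Hx.
assert (K : forall e, is_derive (fun x => a (z x) e) x
    (grad (fun p => a p e) (z x) z')).
  intros e; exact (is_derive_along (fun p => a p e) z x z' _
    (form_diff (z x) e Hx) Hz).
apply is_derive_R4 in Hv; destruct Hv as [[V1 V2] [V3 V4]].
assert (M : forall (f g : R -> R) f' g', is_derive f x f' -> is_derive g x g' ->
    is_derive (fun x => f x * g x) x (f' * g x + f x * g')).
  intros f g f' g' Hf Hg.
  exact (is_derive_mult f g x f' g' Hf Hg Rmult_comm).
(* This use of [eq_ind] proves the derivative with the value produced by the rules and leaves as
   last goal that this value is the required one. *)
refine (eq_ind _ (is_derive _ x) (is_derive_plus _ _ x _ _ (is_derive_plus _ _ x _ _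
  (is_derive_plus _ _ x _ _ (M _ _ _ _ V1 (K _)) (M _ _ _ _ V2 (K _)))
  (M _ _ _ _ V3 (K _))) (M _ _ _ _ V4 (K _))) _ _).
unfold plus; simpl; unfold_sorts; ring.
Qed.

(* Stokes' theorem, differentiated in the parameter of the homotopy; E is a
   primitive in s of the pull-back of da. *)
Lemma is_derive_homotopy (X : R -> Prop) (z zx zs zxs : R -> R -> R4)
  (E : R -> R) (x0 : R) : open X -> X x0 ->
  (forall x s, X x -> D (z x s)) ->
  (forall x s, X x -> is_derive (fun x => z x s) x (zx x s)) ->
  (forall x s, X x -> is_derive (fun s => z x s) s (zs x s)) ->
  (forall x s, X x -> is_derive (fun x => zs x s) x (zxs x s)) ->
  (forall x s, X x -> is_derive (fun s => zx x s) s (zxs x s)) ->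
  (forall f, In f (z :: zx :: zs :: zxs :: nil) -> forall x s, X x ->
     continuous (fun u : R * R => f (fst u) (snd u)) (x, s)) ->
  (forall s, is_derive E s (ext_d a (z x0 s) (zx x0 s) (zs x0 s))) ->
  is_derive (fun x => RInt (fun s => a (z x s) (zs x s)) 0 1) x0
    (a (z x0 1) (zx x0 1) + E 1 - (a (z x0 0) (zx x0 0) + E 0)).
Proof.
intros HX Hx0 Dz Hx Hs Hsx Hxs HC HE.
pose (f' := fun x s =>
  grad (fun p => a p (zs x s)) (z x s) (zx x s) + a (z x s) (zxs x s)).
assert (Cz := HC z ltac:(simpl; tauto)); assert (Czx := HC zx ltac:(simpl; tauto)).
assert (Czs := HC zs ltac:(simpl; tauto)); assert (Czxs := HC zxs ltac:(simpl; tauto)).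
assert (a_C0 : forall u, Ck_on 0 D (fun p => a p u)).
  intros u; apply Ck_on_S, a_C1.
assert (Hf : forall x s, X x -> is_derive (fun x => a (z x s) (zs x s)) x (f' x s)).
  intros x s HXx; exact (form_is_derive (fun x => z x s) (fun x => zs x s) x _ _
    (Dz x s HXx) (Hx x s HXx) (Hsx x s HXx)).
assert (Cf : forall x s, X x ->
    continuous (fun u : R * R => f' (fst u) (snd u)) (x, s)).
  intros x s HXx.
  exact (continuous_plus _ _ _
    (form_grad_continuous _ _ _ (x, s) (Dz x s HXx) (Cz x s HXx) (Czs x s HXx)
      (Czx x s HXx))
    (form_continuous _ _ (x, s) a_C0 (Dz x s HXx) (Cz x s HXx) (Czxs x s HXx))).
assert (slice : forall (g : R * R -> R) x s, continuous g (x, s) ->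
    continuous (fun s => g (x, s)) s).
  intros g x s Hg.
  apply (continuous_comp (V := prod_UniformSpace R_UniformSpace R_UniformSpace)
    (fun s : R => (x, s)) g); [|exact Hg].
  apply continuous_pair; [apply continuous_const | apply continuous_id].
refine (eq_ind _ (is_derive _ x0) (is_derive_RInt_param _ 0 1 x0 _ _ _) _ _).
- generalize (HX x0 Hx0); apply filter_imp; intros x HXx s _.
  exists (f' x s); apply Hf, HXx.
- intros s _; apply (continuity_2d_pt_ext_loc f').
    destruct (HX x0 Hx0) as [e He]; exists e; intros x t Bx _.
    symmetry; apply is_derive_unique, Hf, He, Bx.
  apply continuity_2d_pt_filterlim; exact (Cf x0 s Hx0).
- generalize (HX x0 Hx0); apply filter_imp; intros x HXx.
  apply (ex_RInt_continuous (V := R_CompleteNormedModule)); intros s _.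
  apply (slice (fun u => a (z (fst u) (snd u)) (zs (fst u) (snd u)))).
  exact (form_continuous _ _ (x, s) a_C0 (Dz x s HXx) (Cz x s HXx) (Czs x s HXx)).
- rewrite (RInt_ext _ (f' x0)) by
    (intros s _; apply is_derive_unique, Hf, Hx0).
  apply is_RInt_unique.
  (* The mixed term [zxs] occurs both in the x-derivative of a(zs) and in the s-derivative of a(zx),
     so these differ exactly by [ext_d a], whose antiderivative is [E]. *)
  apply (is_RInt_derive (fun s => a (z x0 s) (zx x0 s) + E s)).
  + intros s _.
    refine (eq_ind _ (is_derive _ s) (is_derive_plus _ _ s _ _ (form_is_derive
      (fun s => z x0 s) (fun s => zx x0 s) s _ _
      (Dz x0 s Hx0) (Hs x0 s Hx0) (Hxs x0 s Hx0)) (HE s)) _ _).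
    unfold f', ext_d, grad, plus; simpl; unfold_sorts; ring.
  + intros s _; exact (slice _ x0 s (Cf x0 s Hx0)).
Qed.

End Forms.

(** * The action integrals *)

Definition pull (alpha : R4 -> R4 -> R) (p u : R4) : R :=
  alpha (Tpar p) (dTpar p u).

Lemma Ck_on_Tpar (n : nat) (D : R4 -> Prop) :
  (Ck_on n D (fun p => fst (fst (Tpar p))) /\
   Ck_on n D (fun p => snd (fst (Tpar p)))) /\
  (Ck_on n D (fun p => fst (snd (Tpar p))) /\
   Ck_on n D (fun p => snd (snd (Tpar p)))).
Proof.
destruct (Ck_on_R4_coords n D) as [[A B] [X Y]].
destruct (Ck_on_cos_sin n D _ Y) as [c s].
destruct (Ck_on_cos_sin n D _ (Ck_on_opp _ _ _ Y)) as [c' s'].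
assert (e := Ck_on_exp n D _ X); assert (e' := Ck_on_exp n D _ (Ck_on_opp _ _ _ X)).
assert (M := Ck_on_mult (V := R4) n D).
assert (z : forall f g : R4 -> R, (forall p, g p = f p) -> Ck_on n D f ->
    Ck_on n D g).
  intros f g H Hf; replace g with f; [exact Hf|].
  apply functional_extensionality; intros p; symmetry; apply H.
split; split.
- refine (z _ _ (fun p => f_equal (fun z => fst (fst z)) (Tpar_eq p)) _).
  exact (Ck_on_minus _ _ _ _ (M _ _ A (M _ _ e' c)) (M _ _ B (M _ _ e' s))).
- refine (z _ _ (fun p => f_equal (fun z => snd (fst z)) (Tpar_eq p)) _).
  exact (Ck_on_plus _ _ _ _ (M _ _ A (M _ _ e' s)) (M _ _ B (M _ _ e' c))).
- refine (z _ _ (fun p => f_equal (fun z => fst (snd z)) (Tpar_eq p)) _).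
  exact (M _ _ e c').
- refine (z _ _ (fun p => f_equal (fun z => snd (snd z)) (Tpar_eq p)) _).
  exact (M _ _ e s').
Qed.

Lemma Ck_on_linear_Tpar (n : nat) (D : R4 -> Prop) (l : R4 -> R) :
  is_linear l -> Ck_on (V := R4) n D (fun p => l (Tpar p)).
Proof.
intros Hl; destruct (Ck_on_Tpar n D) as [[A B] [X Y]].
assert (M : forall (f : R4 -> R) r, Ck_on n D f -> Ck_on n D (fun p => f p * r)).
  intros f r Hf; exact (Ck_on_mult n D _ _ Hf (Ck_on_const n D r)).
assert (K := Ck_on_plus n D _ _ (Ck_on_plus n D _ _ (Ck_on_plus n D _ _
  (M _ (l ((1, 0), (0, 0))) A) (M _ (l ((0, 1), (0, 0))) B))
  (M _ (l ((0, 0), (1, 0))) X)) (M _ (l ((0, 0), (0, 1))) Y)).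
replace (fun p : R4 => l (Tpar p)) with (fun p : R4 =>
  fst (fst (Tpar p)) * l ((1, 0), (0, 0)) +
  snd (fst (Tpar p)) * l ((0, 1), (0, 0)) +
  fst (snd (Tpar p)) * l ((0, 0), (1, 0)) +
  snd (snd (Tpar p)) * l ((0, 0), (0, 1))); [exact K|].
apply functional_extensionality; intros p; symmetry; exact (linear_R4 l Hl _).
Qed.

Lemma grad_linear_Tpar (l : R4 -> R) (p u : R4) : is_linear l ->
  grad (fun p : R4 => l (Tpar p)) p u = l (dTpar p u).
Proof.
intros Hl; apply (grad_eq (fun p : R4 => l (Tpar p)) p (fun u => l (dTpar p u))).
apply (filterdiff_comp' (Tpar : R4 -> R4) l p (dTpar p) l (diff_Tpar p)).
apply filterdiff_linear, Hl.
Qed.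

Lemma is_linear_coords :
  (is_linear (fun p : R4 => fst (fst p)) /\
   is_linear (fun p : R4 => snd (fst p))) /\
  (is_linear (fun p : R4 => fst (snd p)) /\
   is_linear (fun p : R4 => snd (snd p))).
Proof.
split; split.
- exact (is_linear_comp _ _ is_linear_R4_fst is_linear_R2_fst).
- exact (is_linear_comp _ _ is_linear_R4_fst is_linear_R2_snd).
- exact (is_linear_comp _ _ is_linear_R4_snd is_linear_R2_fst).
- exact (is_linear_comp _ _ is_linear_R4_snd is_linear_R2_snd).
Qed.

Lemma is_derive_linear_dTpar (l : R4 -> R) (p u w : R4) : is_linear l ->
  is_derive (fun s : R => l (dTpar (plus p (scal s u)) w)) 0
    (grad (fun q : R4 => grad (fun q : R4 => l (Tpar q)) q w) p u) /\
  is_derive (fun s : R => l (dTpar (plus p (scal s w)) u)) 0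
    (grad (fun q : R4 => grad (fun q : R4 => l (Tpar q)) q w) p u).
Proof.
intros Hl.
assert (C2 := Ck_on_linear_Tpar 2 (fun _ => True) l Hl).
assert (H : forall u w : R4, is_derive
    (fun s : R => l (dTpar (plus p (scal s u)) w)) 0
    (grad (fun q : R4 => grad (fun q : R4 => l (Tpar q)) q w) p u)).
  intros u' w'.
  apply (is_derive_ext (fun s : R =>
    grad (fun q : R4 => l (Tpar q)) (plus p (scal s u')) w')).
    intros s; exact (grad_linear_Tpar l _ w' Hl).
  apply (diff_line_0 (fun q : R4 => grad (fun q : R4 => l (Tpar q)) q w')).
  apply (grad_filterdiff (fun _ => True) 0); [|exact I].
  apply grad_Ck; [apply open_true | exact C2].
split; [apply H|].
rewrite (grad_sym (fun _ => True) _ u w p open_true C2 I); apply H.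
Qed.

(** In a fixed direction [dTpar] is a gradient of the components of [Tpar], so the common value [d]
    is a symmetric second derivative. It is the term that cancels in [pull_ext_d]. *)
Lemma dTpar_sym (p u w : R4) : exists d : R4,
  is_derive (fun s : R => dTpar (plus p (scal s u)) w : R4) 0 d /\
  is_derive (fun s : R => dTpar (plus p (scal s w)) u : R4) 0 d.
Proof.
destruct is_linear_coords as [[L1 L2] [L3 L4]].
destruct (is_derive_linear_dTpar _ p u w L1) as [H1 H1'].
destruct (is_derive_linear_dTpar _ p u w L2) as [H2 H2'].
destruct (is_derive_linear_dTpar _ p u w L3) as [H3 H3'].
destruct (is_derive_linear_dTpar _ p u w L4) as [H4 H4'].
eexists ((_, _), (_, _)); split; apply is_derive_R4; split; split.
- exact H1.
- exact H2.
- exact H3.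
- exact H4.
- exact H1'.
- exact H2'.
- exact H3'.
- exact H4'.
Qed.

(** * Regularity of the pulled-back form and naturality of the exterior derivative *)

Section Pullback.

Variables (S : R2 -> R) (W : C -> Prop) (alpha : R4 -> R4 -> R).
Hypothesis W_open : open (T := C_UniformSpace) W.
Hypothesis alpha_W : primitive_over S W alpha.

Notation WT := (fun p : R4 => W (fst p)).

Lemma open_fst (D : C -> Prop) :
  open (T := C_UniformSpace) D -> open (fun p : R4 => D (fst p)).
Proof.
intros HD; apply (open_comp (T := R4) (U := R2) fst D); [|exact HD].
intros p _; exact (linear_cont (fst : R4 -> R2) p is_linear_R4_fst).
Qed.

Lemma Tpar_over (p : R4) : WT p -> W (pi_can (Tpar p)).
Proof. intros Hp; rewrite pi_can_Tpar; exact Hp. Qed.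

Lemma pull_linear (p : R4) : WT p -> is_linear (pull alpha p).
Proof.
intros Hp; apply (is_linear_comp (dTpar p : R4 -> R4) (alpha (Tpar p))).
- exact (proj1 (diff_Tpar p)).
- exact (proj1 alpha_W (Tpar p) (Tpar_over p Hp)).
Qed.

Lemma pull_C1 (u : R4) : Ck_on 1 WT (fun p => pull alpha p u).
Proof.
destruct alpha_W as [lin [smooth _]].
destruct is_linear_coords as [[L1 L2] [L3 L4]].
assert (A : forall e, Ck_on 1 WT (fun p : R4 => alpha (Tpar p) e)).
  intros e; destruct (Ck_on_Tpar 1 WT) as [[T1 T2] [T3 T4]].
  (* Surjective pairing, since [Ck_on_comp_R4] requires its argument as an explicit quadruple of
     coordinates. *)
  assert (E : forall p, ((fst (fst (Tpar p)), snd (fst (Tpar p))),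
      (fst (snd (Tpar p)), snd (snd (Tpar p)))) = Tpar p).
    intros p; destruct (Tpar p) as [[x y] [x' y']]; reflexivity.
  apply (Ck_on_ext 1 WT (fun p : R4 =>
    alpha ((fst (fst (Tpar p)), snd (fst (Tpar p))),
      (fst (snd (Tpar p)), snd (snd (Tpar p)))) e)).
  - exact (open_fst W W_open).
  - intros p _; exact (f_equal (fun z => alpha z e) (E p)).
  - apply (Ck_on_comp_R4 1 (fun z => W (pi_can z)) WT (fun z => alpha z e)
      _ _ _ _ (smooth e 1%nat) T1 T2 T3 T4).
    intros p Hp.
    exact (eq_ind_r (fun z => W (pi_can z)) (Tpar_over p Hp) (E p)).
assert (G : forall l : R4 -> R, is_linear l ->
    Ck_on 1 WT (fun p : R4 => l (dTpar p u))).
  intros l Hl.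
  apply (Ck_on_ext 1 WT (fun p => grad (fun p : R4 => l (Tpar p)) p u)).
  - exact (open_fst W W_open).
  - intros p _; exact (grad_linear_Tpar l p u Hl).
  - apply grad_Ck; [exact (open_fst W W_open)|].
    exact (Ck_on_linear_Tpar 2 WT l Hl).
apply (Ck_on_ext 1 WT (fun p : R4 =>
  fst (fst (dTpar p u)) * alpha (Tpar p) ((1, 0), (0, 0)) +
  snd (fst (dTpar p u)) * alpha (Tpar p) ((0, 1), (0, 0)) +
  fst (snd (dTpar p u)) * alpha (Tpar p) ((0, 0), (1, 0)) +
  snd (snd (dTpar p u)) * alpha (Tpar p) ((0, 0), (0, 1)))).
- exact (open_fst W W_open).
- intros p Hp; symmetry.
  exact (linear_R4 _ (lin _ (Tpar_over p Hp)) (dTpar p u)).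
- exact (Ck_on_plus _ _ _ _ (Ck_on_plus _ _ _ _ (Ck_on_plus _ _ _ _
    (Ck_on_mult _ _ _ _ (G _ L1) (A _)) (Ck_on_mult _ _ _ _ (G _ L2) (A _)))
    (Ck_on_mult _ _ _ _ (G _ L3) (A _))) (Ck_on_mult _ _ _ _ (G _ L4) (A _))).
Qed.

(** Each of the two derivatives in [ext_d] gains a term from the variation of [dTpar]; by
    [dTpar_sym] both terms are [alpha (Tpar p) d], and their difference vanishes. *)
Lemma pull_ext_d (p u w : R4) : WT p ->
  ext_d (pull alpha) p u w = omega_can (dTpar p u) (dTpar p w).
Proof.
intros Hp; destruct alpha_W as [lin [smooth [_ dalpha]]].
rewrite <- (dalpha (Tpar p) _ _ (Tpar_over p Hp)).
destruct (dTpar_sym p u w) as [d [Hu Hw]].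
assert (K : forall u w, is_derive
    (fun s : R => dTpar (plus p (scal s u)) w : R4) 0 d ->
    is_derive (fun s => pull alpha (plus p (scal s u)) w) 0
      (grad (fun z => alpha z (dTpar p w)) (Tpar p) (dTpar p u) +
       alpha (Tpar p) d)).
  intros u' w' Hd.
  assert (L := form_is_derive (fun z => W (pi_can z)) alpha
    (open_pi_can W W_open) lin (fun v => smooth v 1%nat)
    (fun s : R => Tpar (plus p (scal s u'))) (fun s => dTpar (plus p (scal s u')) w')
    0 (dTpar p u') d).
  cbv beta in L; rewrite plus_scal_0 in L; apply L; [| |exact Hd].
    exact (Tpar_over p Hp).
  apply (is_derive_along (Tpar : R4 -> R4) (fun s => plus p (scal s u')) 0 u'
    (dTpar p)).
    rewrite plus_scal_0; apply diff_Tpar.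
  exact (is_derive_line p u' 0).
refine (eq_trans (f_equal2 Rminus (is_derive_unique _ _ _ (K u w Hu))
  (is_derive_unique _ _ _ (K w u Hw))) _).
unfold ext_d, grad; ring.
Qed.

End Pullback.

Lemma is_derive_cst (a x : R) : is_derive (fun _ : R => a) x 0.
Proof. exact (is_derive_const (K := R_AbsRing) (V := R_NormedModule) a x). Qed.

Section Interpolation.

Variables (l l' g g' : R -> R) (r x s : R).
Hypothesis l_diff : is_derive l x (l' x).
Hypothesis g_diff : is_derive g s (g' s).
Hypothesis l'_cont : continuous l' x.
Hypothesis g'_cont : continuous g' s.

Notation R2' := (prod_UniformSpace R_UniformSpace R_UniformSpace).

(** The interpolated function is one time coordinate of the homotopy: [l x] is the period over the
    moving base point, [g] the given loop, [r] the period at the end x = 1. It is the straight loop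
    for x = 0 and [g] for x = 1, and since [g] is displaced by [r], each intermediate path is
    displaced by exactly [l x]. *)
Lemma interpolation_diff :
  (is_derive (fun x => s * l x + x * (g s - s * r)) x (s * l' x + (g s - s * r)) /\
   is_derive (fun s => s * l x + x * (g s - s * r)) s (l x + x * (g' s - r))) /\
  (is_derive (fun x => l x + x * (g' s - r)) x (l' x + (g' s - r)) /\
   is_derive (fun s => s * l' x + (g s - s * r)) s (l' x + (g' s - r))).
Proof.
assert (dl : Derive (fun x => l x) x = l' x) by exact (is_derive_unique _ _ _ l_diff).
assert (dg : Derive (fun s => g s) s = g' s) by exact (is_derive_unique _ _ _ g_diff).
assert (el : ex_derive l x) by (exists (l' x); exact l_diff).
assert (eg : ex_derive g s) by (exists (g' s); exact g_diff).
split; split; auto_derive; try tauto; try exact I; rewrite ?dl, ?dg; ring.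
Qed.

Lemma interpolation_cont :
  (continuous (U := R_UniformSpace) (fun u : R2' =>
     snd u * l (fst u) + fst u * (g (snd u) - snd u * r)) (x, s) /\
   continuous (U := R_UniformSpace) (fun u : R2' =>
     snd u * l' (fst u) + (g (snd u) - snd u * r)) (x, s)) /\
  (continuous (U := R_UniformSpace) (fun u : R2' =>
     l (fst u) + fst u * (g' (snd u) - r)) (x, s) /\
   continuous (U := R_UniformSpace) (fun u : R2' =>
     l' (fst u) + (g' (snd u) - r)) (x, s)).
Proof.
assert (l_cont : continuous l x).
  exact (ex_derive_continuous l x (ex_intro _ _ l_diff)).
assert (g_cont : continuous g s).
  exact (ex_derive_continuous g s (ex_intro _ _ g_diff)).
assert (F : continuous (U := R_UniformSpace) (fun u : R2' => fst u) (x, s)).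
  apply continuous_fst.
assert (G : continuous (U := R_UniformSpace) (fun u : R2' => snd u) (x, s)).
  apply continuous_snd.
assert (r_cont : continuous (U := R_UniformSpace) (fun u : R2' => r) (x, s)).
  apply continuous_const.
assert (P := fun f h => continuous_plus (U := R2') (V := R_NormedModule) f h (x, s)).
assert (N := fun f h => continuous_minus (U := R2') (V := R_NormedModule) f h (x, s)).
assert (M := fun f h => continuous_mult (U := R2') (K := R_AbsRing) f h (x, s)).
assert (cl := continuous_comp (U := R2') (fun u => fst u) l (x, s) F l_cont).
assert (cl' := continuous_comp (U := R2') (fun u => fst u) l' (x, s) F l'_cont).
assert (cg := continuous_comp (U := R2') (fun u => snd u) g (x, s) G g_cont).
assert (cg' := continuous_comp (U := R2') (fun u => snd u) g' (x, s) G g'_cont).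
split; split.
- exact (P _ _ (M _ _ G cl) (M _ _ F (N _ _ cg (M _ _ G r_cont)))).
- exact (P _ _ (M _ _ G cl') (N _ _ cg (M _ _ G r_cont))).
- exact (P _ _ cl (M _ _ F (N _ _ cg' r_cont))).
- exact (P _ _ cl' (N _ _ cg' r_cont)).
Qed.

End Interpolation.

Section Action_integral.

Variables (S : R2 -> R) (W : C -> Prop) (alpha : R4 -> R4 -> R).
Variables (L1 L2 : R2 -> R) (zg : C -> R) (deck : R4 -> R4).
Hypothesis W_open : open (T := C_UniformSpace) W.
Hypothesis alpha_W : primitive_over S W alpha.
Hypothesis L1_C1 : Ck_on (V := R2) 1 W L1.
Hypothesis L2_C1 : Ck_on (V := R2) 1 W L2.
Hypothesis zg_diff : forall c : R2, W c ->
  filterdiff (zg : R2 -> R) (locally c)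
    (fun v : R2 => / (2 * PI) * (L1 c * fst v + L2 c * snd v)).
Hypothesis deck_invariant : forall z : R4, W (pi_can z) ->
  exists ddeck : R4 -> R4, filterdiff deck (locally z) ddeck /\
    forall v, alpha (deck z) (ddeck v) = alpha z v.
Hypothesis deck_Tpar : forall (c : C) (t : R * R), W c ->
  deck (Tpar (c, (fst t + L1 c, snd t + L2 c))) = Tpar (c, t).

Notation WT := (fun p : R4 => W (fst p)).

(** The identity between the two curves is differentiated and inserted into the invariance of
    [alpha]; this is why the boundary terms of Stokes' theorem cancel. *)
Lemma pull_deck (z0 z1 : R -> R4) (x : R) (v0 v1 : R4) :
  locally x (fun x => deck (Tpar (z1 x)) = Tpar (z0 x)) ->
  W (fst (z1 x)) -> is_derive z0 x v0 -> is_derive z1 x v1 ->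
  pull alpha (z1 x) v1 = pull alpha (z0 x) v0.
Proof.
intros E Hx H0 H1.
destruct (deck_invariant (Tpar (z1 x)) (Tpar_over W _ Hx)) as [dd [Hd inv]].
unfold pull; rewrite <- inv.
assert (Ex := locally_singleton _ _ E); cbv beta in Ex; rewrite Ex; f_equal.
apply (is_derive_R4_unique (fun x => Tpar (z0 x)) x).
- apply (is_derive_ext_loc (fun x => deck (Tpar (z1 x)) : R4)); [exact E|].
  apply (is_derive_along deck (fun x => Tpar (z1 x)) x _ dd Hd).
  exact (is_derive_along (Tpar : R4 -> R4) z1 x v1 _ (diff_Tpar _) H1).
- exact (is_derive_along (Tpar : R4 -> R4) z0 x v0 _ (diff_Tpar _) H0).
Qed.

Lemma path_integral_pull (c : C) (g : R -> R * R) :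
  (forall s, ex_derive (fun x => fst (g x)) s /\
             ex_derive (fun x => snd (g x)) s) ->
  path_integral alpha (fun s => Tpar (c, g s)) =
  RInt (fun s => pull alpha (c, g s)
    ((0, 0), (Derive (fun x => fst (g x)) s, Derive (fun x => snd (g x)) s))) 0 1.
Proof.
intros Hg; apply RInt_ext; intros s _.
refine (f_equal (alpha (Tpar (c, g s))) _).
destruct (Hg s) as [H1 H2]; apply Derive_correct in H1; apply Derive_correct in H2.
set (d1 := Derive _ _) in *; set (d2 := Derive (fun x => snd (g x)) s) in *.
assert (Hz : is_derive (fun s => (c, g s) : R4) s (((0, 0), (d1, d2)) : R4)).
  apply is_derive_R4; split; split.
  - exact (is_derive_cst (fst c) s).
  - exact (is_derive_cst (snd c) s).
  - exact H1.
  - exact H2.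
assert (H := is_derive_along (Tpar : R4 -> R4) _ s _ _ (diff_Tpar _) Hz).
apply is_derive_R4 in H; destruct H as [[A B] [X Y]].
unfold velocity.
apply injective_projections; apply injective_projections;
  apply is_derive_unique; assumption.
Qed.

(* The homotopy x |-> z x joins the straight loop over c0 to the loop g over c
   through loops over the segment from c0 to c; Stokes' theorem makes the
   derivative of the integral of alpha equal to that of 2 pi zg. *)
Lemma action_along_segment (c0 c : C) (g : R -> R * R) :
  (forall x, 0 <= x <= 1 -> W (fst c0 + x * (fst c - fst c0),
                               snd c0 + x * (snd c - snd c0))) ->
  fibre_loop (L1 c, L2 c) g ->
  2 * PI * zg c - path_integral alpha (fun s => Tpar (c, g s)) =
  2 * PI * zg c0 - RInt (fun s => pull alpha (c0, (s * L1 c0, s * L2 c0))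
    ((0, 0), (L1 c0, L2 c0))) 0 1.
Proof.
intros seg [Hg [end1 end2]]; cbn [fst snd] in end1, end2.
pose (d := (fst c - fst c0, snd c - snd c0) : R2).
pose (cx := fun x : R => (fst c0 + x * fst d, snd c0 + x * snd d) : R2).
pose (X := fun x : R => W (cx x)).
pose (l1 := fun x => grad L1 (cx x) d); pose (l2 := fun x => grad L2 (cx x) d).
pose (g1 := fun s => fst (g s)); pose (g2 := fun s => snd (g s)).
pose (z := fun x s : R => (cx x,
  (s * L1 (cx x) + x * (g1 s - s * L1 c),
   s * L2 (cx x) + x * (g2 s - s * L2 c))) : R4).
pose (zx := fun x s : R => (d,
  (s * l1 x + (g1 s - s * L1 c), s * l2 x + (g2 s - s * L2 c))) : R4).
pose (zs := fun x s : R => ((0, 0),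
  (L1 (cx x) + x * (Derive g1 s - L1 c),
   L2 (cx x) + x * (Derive g2 s - L2 c))) : R4).
pose (zxs := fun x s : R => ((0, 0),
  (l1 x + (Derive g1 s - L1 c), l2 x + (Derive g2 s - L2 c))) : R4).
assert (line : forall a b x : R, is_derive (fun x => a + x * b) x b).
  intros a b x; auto_derive; [exact I | ring].
assert (dcx : forall x, is_derive cx x d).
  intros x.
  exact (diff_pair (V := AbsRing_NormedModule R_AbsRing) _ _ _ _ _
    (line (fst c0) (fst d) x) (line (snd c0) (snd d) x)).
assert (ccx : forall x, continuous cx x).
  intros x; exact (ex_derive_continuous cx x (ex_intro _ _ (dcx x))).
assert (X_open : open X).
  apply (open_comp (U := R2) cx W); [|exact W_open].
  intros x _; apply ccx.
assert (X01 : forall x, 0 <= x <= 1 -> X x) by exact seg.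
assert (cx0 : cx 0 = c0) by (apply injective_projections; simpl; ring).
assert (cx1 : cx 1 = c) by (apply injective_projections; simpl; ring).
assert (comp : forall L x, Ck_on (V := R2) 1 W L -> X x ->
    is_derive (fun x => L (cx x)) x (grad L (cx x) d) /\
    continuous (fun x => grad L (cx x) d) x).
  intros L x HL Hx; split.
    exact (is_derive_along L cx x d _ (grad_filterdiff W 0 L _ HL Hx) (dcx x)).
  apply (continuous_comp (V := R2) cx (fun c => grad L c d)); [apply ccx|].
  exact (grad_Ck W 0 L d W_open HL (cx x) Hx).
assert (dg1 : forall s, is_derive g1 s (Derive g1 s)).
  intros s; apply Derive_correct; exact (proj1 (Hg s)).
assert (dg2 : forall s, is_derive g2 s (Derive g2 s)).
  intros s; apply Derive_correct; exact (proj1 (proj2 (Hg s))).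
assert (I1 := fun x s (Hx : X x) => interpolation_diff (fun x => L1 (cx x)) l1 g1
  (Derive g1) (L1 c) x s (proj1 (comp L1 x L1_C1 Hx)) (dg1 s)).
assert (I2 := fun x s (Hx : X x) => interpolation_diff (fun x => L2 (cx x)) l2 g2
  (Derive g2) (L2 c) x s (proj1 (comp L2 x L2_C1 Hx)) (dg2 s)).
assert (C1 := fun x s (Hx : X x) => interpolation_cont (fun x => L1 (cx x)) l1 g1
  (Derive g1) (L1 c) x s (proj1 (comp L1 x L1_C1 Hx)) (dg1 s)
  (proj2 (comp L1 x L1_C1 Hx)) (proj1 (proj2 (proj2 (Hg s))))).
assert (C2 := fun x s (Hx : X x) => interpolation_cont (fun x => L2 (cx x)) l2 g2
  (Derive g2) (L2 c) x s (proj1 (comp L2 x L2_C1 Hx)) (dg2 s)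
  (proj2 (comp L2 x L2_C1 Hx)) (proj2 (proj2 (proj2 (Hg s))))).
assert (J : forall x, X x -> is_derive
    (fun x => RInt (fun s => pull alpha (z x s) (zs x s)) 0 1) x
    (fst d * L1 (cx x) + snd d * L2 (cx x))).
  intros x0 Hx0.
  (* The s-derivative [zs] has no base component and [zx] has base component [d], so by
     [omega_dTpar] the pulled-back form takes the value d . (dt/ds) on them, with antiderivative d .
     t. Between s = 0 and s = 1 this grows by d . (L1, L2), which is 2 pi times the derivative of
     [zg]. *)
  refine (eq_ind _ (is_derive _ x0) (is_derive_homotopy WT (pull alpha)
    (open_fst W W_open) (pull_linear S W alpha alpha_W)
    (pull_C1 S W alpha W_open alpha_W) X z zx zs zxs
    (fun s => fst d * fst (snd (z x0 s)) + snd d * snd (snd (z x0 s))) x0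
    X_open Hx0 _ _ _ _ _ _ _) _ _).
  - intros x s Hx; exact Hx.
  - intros x s Hx; apply is_derive_R4; split; split.
    + exact (line (fst c0) (fst d) x).
    + exact (line (snd c0) (snd d) x).
    + exact (proj1 (proj1 (I1 x s Hx))).
    + exact (proj1 (proj1 (I2 x s Hx))).
  - intros x s Hx; apply is_derive_R4; split; split.
    + exact (is_derive_cst (fst (cx x)) s).
    + exact (is_derive_cst (snd (cx x)) s).
    + exact (proj2 (proj1 (I1 x s Hx))).
    + exact (proj2 (proj1 (I2 x s Hx))).
  - intros x s Hx; apply is_derive_R4; split; split.
    + exact (is_derive_cst 0 x).
    + exact (is_derive_cst 0 x).
    + exact (proj1 (proj2 (I1 x s Hx))).
    + exact (proj1 (proj2 (I2 x s Hx))).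
  - intros x s Hx; apply is_derive_R4; split; split.
    + exact (is_derive_cst (fst d) s).
    + exact (is_derive_cst (snd d) s).
    + exact (proj2 (proj2 (I1 x s Hx))).
    + exact (proj2 (proj2 (I2 x s Hx))).
  - assert (cc := fun (x s : R) (h : R -> R) (Hh : continuous h x) =>
      continuous_comp (U := prod_UniformSpace R_UniformSpace R_UniformSpace)
        (fun u => fst u) h (x, s) (continuous_fst x s) Hh).
    assert (k := fun (x s a : R) => continuous_const
      (U := prod_UniformSpace R_UniformSpace R_UniformSpace)
      (V := R_UniformSpace) a (x, s)).
    assert (cl := fun x s a b => cc x s (fun x => a + x * b)
      (ex_derive_continuous _ x (ex_intro _ _ (line a b x)))).
    intros f Hf x s Hx; destruct Hf as [<- | [<- | [<- | [<- | []]]]];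
      apply continuous_R4; split; split.
    + exact (cl x s (fst c0) (fst d)).
    + exact (cl x s (snd c0) (snd d)).
    + exact (proj1 (proj1 (C1 x s Hx))).
    + exact (proj1 (proj1 (C2 x s Hx))).
    + exact (k x s _).
    + exact (k x s _).
    + exact (proj2 (proj1 (C1 x s Hx))).
    + exact (proj2 (proj1 (C2 x s Hx))).
    + exact (k x s _).
    + exact (k x s _).
    + exact (proj1 (proj2 (C1 x s Hx))).
    + exact (proj1 (proj2 (C2 x s Hx))).
    + exact (k x s _).
    + exact (k x s _).
    + exact (proj2 (proj2 (C1 x s Hx))).
    + exact (proj2 (proj2 (C2 x s Hx))).
  - intros s; rewrite (pull_ext_d S W alpha W_open alpha_W) by exact Hx0.
    rewrite omega_dTpar.
    refine (eq_ind _ (is_derive _ s) (is_derive_plus (K := R_AbsRing)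
      (V := R_NormedModule) _ _ s _ _
      (is_derive_scal (fun s => fst (snd (z x0 s))) s (fst d) _
         (proj2 (proj1 (I1 x0 s Hx0))))
      (is_derive_scal (fun s => snd (snd (z x0 s))) s (snd d) _
         (proj2 (proj1 (I2 x0 s Hx0))))) _ _).
    unfold zx, zs, plus; simpl; unfold_sorts; ring.
  (* For every x near x0 the end of the path is its start shifted by the period over [cx x], so
     [deck_Tpar] holds along both boundary curves. *)
  - assert (P : pull alpha (z x0 1) (zx x0 1) = pull alpha (z x0 0) (zx x0 0)).
      apply (pull_deck (fun x => z x 0) (fun x => z x 1) x0).
      + generalize (X_open x0 Hx0); apply filter_imp; intros x Hx.
        refine (eq_trans (f_equal (fun p => deck (Tpar p)) _)
          (deck_Tpar (cx x) (snd (z x 0)) Hx)).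
        unfold z, g1, g2; cbn [fst snd]; rewrite end1, end2.
        apply f_equal, injective_projections; cbn [fst snd]; ring.
      + exact Hx0.
      + apply is_derive_R4; split; split.
        * exact (line (fst c0) (fst d) x0).
        * exact (line (snd c0) (snd d) x0).
        * exact (proj1 (proj1 (I1 x0 0 Hx0))).
        * exact (proj1 (proj1 (I2 x0 0 Hx0))).
      + apply is_derive_R4; split; split.
        * exact (line (fst c0) (fst d) x0).
        * exact (line (snd c0) (snd d) x0).
        * exact (proj1 (proj1 (I1 x0 1 Hx0))).
        * exact (proj1 (proj1 (I2 x0 1 Hx0))).
    rewrite P; unfold z, g1, g2; cbn [fst snd]; rewrite end1, end2.
    apply Rminus_diag_uniq; unfold_sorts; ring.
assert (F : forall x, 0 <= x <= 1 -> is_derive (fun x => 2 * PI * zg (cx x) -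
    RInt (fun s => pull alpha (z x s) (zs x s)) 0 1) x 0).
  intros x Hx; assert (Xx := X01 x Hx).
  refine (eq_ind _ (is_derive _ x) (is_derive_minus (K := R_AbsRing)
    (V := R_NormedModule) _ _ x _ _
    (is_derive_scal (fun x => zg (cx x)) x (2 * PI) _
      (is_derive_along (zg : R2 -> R) cx x d _ (zg_diff (cx x) Xx) (dcx x)))
    (J x Xx)) _ _).
  unfold minus, plus, opp; simpl; field; apply Rgt_not_eq, PI_RGT_0.
assert (E := eq_is_derive (V := R_NormedModule) _ 0 1 F Rlt_0_1); cbv beta in E.
rewrite cx0, cx1 in E.
rewrite path_integral_pull by (intros s; split; apply (Hg s)).
etransitivity; [|etransitivity; [symmetry; exact E|]].
- f_equal; apply RInt_ext; intros s _; unfold z, zs; rewrite cx1.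
  refine (f_equal2 (pull alpha) _ _); (apply injective_projections;
    [reflexivity | apply injective_projections; cbn [fst snd]]);
    unfold g1, g2; ring.
- f_equal; apply RInt_ext; intros s _; unfold z, zs; rewrite cx0.
  refine (f_equal2 (pull alpha) _ _); (apply injective_projections;
    [reflexivity | apply injective_projections; cbn [fst snd]]); ring.
Qed.

(** The constant is taken from the right-hand side of [action_along_segment], which involves neither
    c nor the loop. The neighbourhood is a ball of the product structure, a square, hence contains
    the segments issuing from c0. *)
Lemma action_near (c0 : C) : W c0 -> exists K : R,
  locally (T := C_UniformSpace) c0 (fun c => forall g,
    fibre_loop (L1 c, L2 c) g ->
    zg c = / (2 * PI) * path_integral alpha (fun s => Tpar (c, g s)) + K).
Proof.
intros H0; destruct (W_open c0 H0) as [e He].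
exists (zg c0 - / (2 * PI) * RInt (fun s => pull alpha
  (c0, (s * L1 c0, s * L2 c0)) ((0, 0), (L1 c0, L2 c0))) 0 1).
exists e; intros c [B1 B2] g Hg.
assert (P := PI_RGT_0).
assert (near : forall a b x : R, ball a e b -> 0 <= x <= 1 ->
    ball a e (a + x * (b - a))).
  intros a b x Hb Hx.
  change (Rabs (a + x * (b - a) - a) < e); change (Rabs (b - a) < e) in Hb.
  replace (a + x * (b - a) - a) with (x * (b - a)) by ring.
  rewrite Rabs_mult, (Rabs_pos_eq x) by lra.
  generalize (Rabs_pos (b - a)); nra.
assert (K := action_along_segment c0 c g).
assert (E : 2 * PI * zg c - path_integral alpha (fun s => Tpar (c, g s)) =
  2 * PI * zg c0 - RInt (fun s => pull alpha (c0, (s * L1 c0, s * L2 c0))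
    ((0, 0), (L1 c0, L2 c0))) 0 1).
  apply K; [|exact Hg].
  intros x Hx; apply He; split; apply near; assumption.
apply (Rmult_eq_reg_l (2 * PI)); [|lra].
rewrite Rmult_plus_distr_l, Rmult_minus_distr_l, <- !Rmult_assoc, Rinv_r by lra.
lra.
Qed.

End Action_integral.

Lemma primitive_over_sub (S : R2 -> R) (V W : C -> Prop)
  (alpha : R4 -> R4 -> R) : (forall c, W c -> V c) ->
  primitive_over S V alpha -> primitive_over S W alpha.
Proof.
intros WV [lin [smooth [inv ext]]]; split; [|split; [|split]]; auto.
intros v n; apply (Ck_on_sub n (fun z : R4 => V (pi_can z))).
  intros z; apply WV.
apply smooth.
Qed.

Section Actions.

Variables (eps : R) (S : R2 -> R) (U : C -> Prop) (arg : C -> R).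
Hypothesis S_smooth : smooth_on (fun _ => True) S.
Hypothesis U_open : open (T := C_UniformSpace) U.
Hypothesis U_B0 : forall c, U c -> B0 eps c.
Hypothesis U_gap : forall c, U c -> S1 S c - ln (Cmod c) <> 0.
Hypothesis arg_U : arg_branch U arg.

Lemma U_nonzero (c : C) : U c -> c <> RtoC 0.
Proof. intros Hc; exact (proj2 (U_B0 c Hc)). Qed.

Lemma action_z_m (c0 : C) : U c0 ->
  is_action_integral eps S c0 (period_m S arg) (z_m S arg).
Proof.
intros H0; split.
  exists U, (primitive S).
  split; [exact U_open | split; [exact H0 | split; [exact U_B0|]]].
  exact (primitive_exists S U S_smooth U_open U_nonzero U_gap).
intros V alpha [V_open [V0 [_ HV]]].
(* The form lives over [V], the branch [arg] over [U]; the homotopy must stay over both. *)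
pose (W := fun c => U c /\ V c).
assert (W_open : open (T := C_UniformSpace) W) by (apply open_and; assumption).
assert (HW : primitive_over S W alpha).
  apply (primitive_over_sub S V); [intros c Hc; apply Hc | exact HV].
assert (WU : forall c, W c -> U c) by (intros c Hc; apply Hc).
apply (action_near S W alpha (fun c => S1 S c - ln (Cmod c))
  (fun c => S2 S c + arg c) (z_m S arg) (psi S) W_open HW).
- exact (Ck_on_sub 1 U W _ WU (Ck_on_tau1 S U S_smooth U_nonzero 1)).
- exact (Ck_on_sub 1 U W _ WU
    (Ck_on_tau2 S U arg S_smooth U_open U_nonzero arg_U 1)).
- intros c Hc.
  exact (diff_z_m S U arg S_smooth U_open U_nonzero arg_U c (WU c Hc)).
- intros z Hz.
  destruct (diff_psi S U S_smooth U_nonzero z (WU _ Hz)) as [dpsi Hpsi].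
  exists dpsi; split; [exact Hpsi|].
  exact (proj1 (proj2 (proj2 HW)) z dpsi Hz Hpsi).
- intros c t Hc; rewrite (psi_Tpar eps S U arg U_B0 arg_U c) by exact (WU c Hc).
  apply f_equal, f_equal, injective_projections; cbn [fst snd period_m]; ring.
- split; assumption.
Qed.

(** The primitive required is the same for both cycles. As [Tpar] does not see the period (0, 2 pi),
    the loop closes already in W and the deck map is the identity. *)
Lemma action_z_e (c0 : C) : U c0 -> is_action_integral eps S c0 period_e z_e.
Proof.
intros H0; split; [exact (proj1 (action_z_m c0 H0))|].
intros V alpha [V_open [V0 [_ HV]]].
apply (action_near S V alpha (fun _ => 0) (fun _ => 2 * PI) z_e (fun z => z)
  V_open HV).
- exact (Ck_on_const 1 V 0).
- exact (Ck_on_const 1 V (2 * PI)).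
- intros c _; apply (diff_ext_lin _ _ _ _ (diff_R2_snd c)).
  intros v; field; apply Rgt_not_eq, PI_RGT_0.
- intros z _; exists (fun v => v); split; [|reflexivity].
  apply filterdiff_id.
- intros c t _; apply Tpar_inj; cbn [fst snd].
  split; [ring | exists 1%Z; ring].
- exact V0.
Qed.

End Actions.

Theorem theorem2p1 (eps : R) (S : R2 -> R) (U : C -> Prop) (arg : C -> R)
    (Heps : 0 < eps < 1)
    (HS : smooth_on (fun _ => True) S)
    (HS0 : S (RtoC 0) = 0)
    (Hlattice : forall c, B0 eps c -> S1 S c - ln (Cmod c) <> 0)
    (HUopen : open (T := C_UniformSpace) U)
    (HU : forall c, U c -> B0 eps c)
    (Harg : arg_branch U arg) :
  (* the parametrization induced by the section Gamma *)
  (forall (c : C) (t1 t2 : R),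
     Tpar (c, (t1, t2)) = (Cmult c (cexp (- t1, t2)), cexp (t1, - t2))) /\
  (forall z : C * C, U (pi_can z) -> exists t : R * R, z = Tpar (pi_can z, t)) /\
  (* smooth local coordinates on the glued space, the angles being mod 2 pi *)
  smooth_on (V := R2) U (z_m S arg) /\
  smooth_on (V := R2) U z_e /\
  smooth_on (V := R4) (fun p => U (fst p)) (theta_m S arg) /\
  smooth_on (V := R4) (fun p => U (fst p)) (theta_e S) /\
  (forall c0, U c0 -> exists V : C -> Prop,
     open (T := C_UniformSpace) V /\ V c0 /\ (forall c, V c -> U c) /\
     forall p q : C * C, V (fst p) -> V (fst q) ->
       (glued eps S (Tpar p) (Tpar q) <->
        z_m S arg (fst p) = z_m S arg (fst q) /\
        z_e (fst p) = z_e (fst q) /\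
        eq_mod_2pi (theta_m S arg p) (theta_m S arg q) /\
        eq_mod_2pi (theta_e S p) (theta_e S q))) /\
  (* in the angle coordinates the period lattice is the standard one *)
  (forall c, U c -> forall a b : R,
     (exists t, period_lattice S arg c t /\
        theta_m S arg (c, t) = a /\ theta_e S (c, t) = b) <->
     (exists m n : Z, a = 2 * PI * IZR m /\ b = 2 * PI * IZR n)) /\
  (* the actions are the action integrals over generators of the homology *)
  (forall c0, U c0 ->
     is_action_integral eps S c0 (period_m S arg) (z_m S arg) /\
     is_action_integral eps S c0 period_e z_e) /\
  (* T^* omega_can = dz_m /\ dtheta_e + dz_e /\ dtheta_m *)
  (forall p : R4, U (fst p) ->
     exists (dT : R4 -> R4) (dzm dze dthm dthe : R4 -> R),
       filterdiff (Tpar : R4 -> R4) (locally p) dT /\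
       filterdiff (fun x : R4 => z_m S arg (fst x)) (locally p) dzm /\
       filterdiff (fun x : R4 => z_e (fst x)) (locally p) dze /\
       filterdiff (theta_m S arg : R4 -> R) (locally p) dthm /\
       filterdiff (theta_e S : R4 -> R) (locally p) dthe /\
       forall v w : R4,
         omega_can (dT v) (dT w) = wedge dzm dthe v w + wedge dze dthm v w).

Proof.
assert (Hgap : forall c, U c -> S1 S c - ln (Cmod c) <> 0).
  intros c Hc; exact (Hlattice c (HU c Hc)).
assert (Hnz : forall c, U c -> c <> RtoC 0).
  intros c Hc; exact (proj2 (HU c Hc)).
split; [exact Tpar_formula|].
split; [intros z Hz; exact (Tpar_surj z (Hnz _ Hz))|].
split; [intros n; apply Ck_on_z_m; assumption|].
split; [intros n; apply Ck_on_R2_snd|].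
split; [intros n; apply Ck_on_theta_m; assumption|].
split; [intros n; apply (Ck_on_theta_e S U); assumption|].
split; [intros c0 H0; apply local_coordinates; assumption|].
split; [intros c Hc; apply (period_lattice_standard S U); assumption|].
split; [|intros p Hp; apply (darboux S U); assumption].
intros c0 H0; split.
- apply (action_z_m eps S U); assumption.
- apply (action_z_e eps S U arg); assumption.
Qed.
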